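(* Let $\lambda$ be an even partition of $N$ and let $\eta=\eta_\lambda$. The Sturm–Liouville problem on $(-\infty,\infty)$ $$-(W_\eta y')' - R_\eta y = \varepsilon W_\eta y,\qquad W_\eta=\eta^{-2}e^{-x^2},\quad R_\eta=\eta^{-3}(\eta''+2x\eta')e^{-x^2},$$ has as its eigenvalues exactly the numbers $$\varepsilon_n = 2(n-N),\qquad n\in I_\lambda.$$ The corresponding eigenfunctions are (up to scalar multiples) the polynomials $H_{\lambda,n}$, $n\in I_\lambda$, and the norming constants are given by $$\int_{\mathbb{R}} H_{\lambda,n}\,H_{\lambda,n'}\,\eta_\lambda^{-2}e^{-x^2}\,dx=\sqrt{\pi}\,2^{n-N}\frac{n!}{\pi_{\lambda,N}(n)}\,\delta_{n,n'},\qquad n,n'\in I_\lambda .$$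
   Context: $\mathbb{N}=\{1,2,\dots\}$, $\mathbb{N}_0=\{0,1,2,\dots\}$. $H_n$ denotes the classical Hermite polynomial: $H_0=1$, $H_1=2x$, $xH_n=\tfrac12H_{n+1}+nH_{n-1}$ for $n\ge1$. $\mathrm{Wr}(f_1,\dots,f_r)=\det\big(f_j^{(i-1)}\big)_{i,j=1}^r$ is the usual Wronskian determinant (equal to $1$ for $r=0$). A partition $\lambda$ of $N\in\mathbb{N}_0$ is a non-increasing, finitely supported sequence of non-negative integers $\lambda_1\ge\lambda_2\ge\dots\ge0$ with sum $N$. Its length $\ell$ is the smallest $\ell\in\mathbb{N}_0$ with $\lambda_{\ell+1}=0$. The partition is even if $\lambda_{2i-1}=\lambda_{2i}$ for every $i\in\mathbb{N}$. (For an even partition the polynomial $\eta_\lambda$ defined below has no real zeros, by the known Krein–Adler theorem.) Given $\lambda$, put $m_i=\lambda_i+\ell-i$ and, for $l\in\mathbb{N}_0$, $$C_{\lambda,l}=2^{l(l-1)/2}\prod_{1\le i<j\le l}(\lambda_i-\lambda_j+j-i),\qquad \pi_{\lambda,l}(n)=\prod_{i=1}^l(n-N-\lambda_i+i),$$ $$\eta_\lambda=C_{\lambda,\ell}^{-1}\,\mathrm{Wr}(H_{m_\ell},\dots,H_{m_1}),\qquad I_\lambda=\{n\in\mathbb{N}_0: n-N+\ell\ge0,\ \pi_{\lambda,\ell}(n)\ne0\},$$ $$H_{\lambda,n}=\big(2^\ell C_{\lambda,\ell}\,\pi_{\lambda,\ell}(n)\big)^{-1}\mathrm{Wr}(H_{m_\ell},\dots,H_{m_1},H_{n-N+\ell}),\qquad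 n\in I_\lambda.$$ The problem is limit-point at $\pm\infty$, so no boundary conditions are imposed: an eigenvalue is a number $\varepsilon$ for which there is a nonzero $y\in L^2(\mathbb{R},W_\eta\,dx)$, with $y,y'$ locally absolutely continuous, satisfying the equation almost everywhere; such a $y$ is an eigenfunction. *)

(* Defs.v *)
From HB Require Import structures.
From mathcomp Require Import all_boot all_order all_algebra.
From mathcomp Require Import all_classical all_reals all_analysis.
From mathcomp Require Import complex.

Set Implicit Arguments.
Unset Strict Implicit.
Unset Printing Implicit Defensive.

Import Order.TTheory GRing.Theory Num.Theory.
Import numFieldNormedType.Exports.

Local Open Scope ring_scope.
Local Open Scope complex_scope.

(* [part] is indexed from 0; see [part_nth] for the 1-based parts. *)
Record int_partition := IntPartition {
  part :> nat -> nat;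
  part_noninc : forall i j, (i <= j)%N -> (part j <= part i)%N;
  part_finsupp : exists k, forall i, (k <= i)%N -> part i = 0%N }.

(* The i-th part lambda_i, for i >= 1. *)
Definition part_nth (lam : int_partition) (i : nat) : nat := lam i.-1.

Lemma part_len_subproof (lam : int_partition) :
  exists l, part_nth lam l.+1 == 0%N.
Proof. by have [k kP] := part_finsupp lam; exists k; rewrite /part_nth kP. Qed.

Definition part_len (lam : int_partition) : nat := ex_minn (part_len_subproof lam).

Definition part_size (lam : int_partition) : nat :=
  \sum_(1 <= i < (part_len lam).+1) part_nth lam i.

Definition even_partition (lam : int_partition) : Prop :=
  forall i, (1 <= i)%N -> part_nth lam (2 * i - 1) = part_nth lam (2 * i).

(* The truncated subtraction is only used for 1 <= i <= part_len lam. *)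
Definition part_m (lam : int_partition) (i : nat) : nat :=
  (part_nth lam i + part_len lam - i)%N.

Definition exc_C (lam : int_partition) (l : nat) : int :=
  2 ^+ (l * l.-1)./2 *
  \prod_(1 <= j < l.+1) \prod_(1 <= i < j)
    ((part_nth lam i)%:Z - (part_nth lam j)%:Z + j%:Z - i%:Z).

Definition exc_pi (lam : int_partition) (l n : nat) : int :=
  \prod_(1 <= i < l.+1)
    (n%:Z - (part_size lam)%:Z - (part_nth lam i)%:Z + i%:Z).

Definition exc_index (lam : int_partition) (n : nat) : bool :=
  (0 <= n%:Z - (part_size lam)%:Z + (part_len lam)%:Z) &&
  (exc_pi lam (part_len lam) n != 0).

Section Polynomials.
Variable R : realType.

Fixpoint hermite (n : nat) : {poly R} :=
  match n with
  | 0%N => 1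
  | 1%N => 2%:P * 'X
  | (k.+1 as m).+1 => 2%:P * 'X * hermite m - (2 * m%:R)%:P * hermite k
  end.

Definition wronskian (s : seq {poly R}) : {poly R} :=
  \det (\matrix_(i < size s, j < size s) (s`_j)^`(i)).

(* H_(m_l), ..., H_(m_1) *)
Definition exc_seq (lam : int_partition) : seq {poly R} :=
  [seq hermite (part_m lam i) | i <- rev (iota 1 (part_len lam))].

Definition exc_eta (lam : int_partition) : {poly R} :=
  ((exc_C lam (part_len lam))%:~R)^-1 *: wronskian (exc_seq lam).

(* Meaningful for [exc_index lam n], where n + l - N is not truncated. *)
Definition exc_hermite (lam : int_partition) (n : nat) : {poly R} :=
  (2 ^+ part_len lam * (exc_C lam (part_len lam))%:~R *
     (exc_pi lam (part_len lam) n)%:~R)^-1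
  *: wronskian (rcons (exc_seq lam)
                      (hermite (n + part_len lam - part_size lam))).

Definition SL_W (eta : {poly R}) (x : R) : R :=
  (eta.[x] ^+ 2)^-1 * expR (- x ^+ 2).

Definition SL_R (eta : {poly R}) (x : R) : R :=
  (eta.[x] ^+ 3)^-1 * (eta^`(2).[x] + 2 * x * eta^`().[x]) * expR (- x ^+ 2).

End Polynomials.

Section SturmLiouville.
Variable R : realType.
Implicit Types (f w q : R -> R) (y : R -> R[i]).

(* epsilon-delta absolute continuity on [a, b], over finite families of
   non-overlapping subintervals [u i, v i]. *)
Definition abs_cont_on (a b : R) f : Prop :=
  forall e : R, 0 < e -> exists2 d : R, 0 < d &
    forall (n : nat) (u v : 'I_n -> R),
      (forall i, [/\ a <= u i, u i <= v i & v i <= b]) ->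
      (forall i j, i != j -> v i <= u j \/ v j <= u i) ->
      \sum_(i < n) (v i - u i) < d ->
      \sum_(i < n) `|f (v i) - f (u i)| < e.

Definition loc_abs_cont f : Prop := forall a b : R, abs_cont_on a b f.

(* Calculus of complex-valued functions of a real variable, componentwise. *)
Definition c_loc_abs_cont y : Prop :=
  loc_abs_cont (fun x => complex.Re (y x)) /\
  loc_abs_cont (fun x => complex.Im (y x)).

Definition c_derivable y (x : R) : Prop :=
  derivable (fun t => complex.Re (y t)) x 1 /\
  derivable (fun t => complex.Im (y t)) x 1.

Definition c_derive y (x : R) : R[i] :=
  (fun t => complex.Re (y t))^`()%classic x +i*
  (fun t => complex.Im (y t))^`()%classic x.

Definition in_L2 w y : Prop :=
  [/\ measurable_fun [set: R]%classic (fun x => complex.Re (y x)),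
      measurable_fun [set: R]%classic (fun x => complex.Im (y x)) &
      (\int[@lebesgue_measure R]_x
         ((complex.Re (y x) ^+ 2 + complex.Im (y x) ^+ 2) * w x)%:E < +oo)%E].

(* Eigenfunctions of -(w y')' - q y = eps w y on the whole line.  Scalars are
   complex.  As y is continuous, being nonzero in L^2 is being nonzero at some
   point (w > 0). *)
Definition SL_eigenfunction w q (eps : R[i]) y : Prop :=
  [/\ exists x, y x != 0,
      in_L2 w y,
      c_loc_abs_cont y,
      (forall x, c_derivable y x) /\ c_loc_abs_cont (c_derive y) &
      {ae @lebesgue_measure R, forall x,
         c_derivable (fun t => (w t)%:C * c_derive y t) x /\
         - c_derive (fun t => (w t)%:C * c_derive y t) x - (q x)%:C * y x
           = eps * (w x)%:C * y x}].

Definition SL_eigenvalue w q (eps : R[i]) : Prop :=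
  exists y, SL_eigenfunction w q eps y.

End SturmLiouville.

(* Main.v *)
Require Import Defs.
From HB Require Import structures.
From mathcomp Require Import all_boot all_order all_algebra.
From mathcomp Require Import perm all_classical all_reals all_analysis.
From mathcomp Require Import complex measurable_realfun polyrcf ring lra zify.

Set Implicit Arguments.
Unset Strict Implicit.
Unset Printing Implicit Defensive.
Import Order.TTheory GRing.Theory Num.Theory.
Import numFieldNormedType.Exports.
Local Open Scope ring_scope.

(** Write P_S for the Wronskian [hW S] of the Hermite polynomials with indices in S and
    P_(S,k) for [hW (rcons S k)]. The eigenfunctions are multiples of the P_(S,k),
    where S consists of the numbers m_i of the partition ([gaps]), k is outside S,
    and n + l = k + N.

    _Algebra_. The Desnanot-Jacobi identity gives P_S P_(S,j,k) as the Wronskian of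
    P_(S,j) and P_(S,k) ([hW_jacobi]): adding j to S is a Darboux transformation. Its
    adjoint is again a first-order relation ([hW_darboux]). From the two relations
    the differential equation of P_(S,k) follows by induction from that of H_k
    ([hW_bil]). They also give, by the same induction, that the densities
    P_(S,k)^2 / P_S^2 e^(-x^2) and c e^(-x^2) differ by the derivative of U e^(-x^2)
    with U rational and c explicit ([gauss_cohom_hW]).

    _The chain_. Let S_0 = S and let S_(j+1) be S_j together with the least number
    that it lacks; this removes the ground state of S_j. For an even partition S
    satisfies the parity condition of Krein and Adler, all S_j inherit it, and after
    finitely many steps S_j is an initial segment of the naturals, with a constant
    Wronskian. Going back from there, a monotonicity argument shows that no P_(S_j) has
    a real zero ([nodeless_step], [adler_nodeless]). Then U above has no real pole,
    since a derivative cannot lose poles, and the norms reduce to the Gaussian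
    integral ([hW_inner]).

    _The spectrum_. Divided by the ground state, a solution at the level S_j satisfies
    (p q')' = - 2 (nu - k_j) p q, where k_j is the least number that S_j lacks. If q
    has finite norm, cutoff functions show that p q'^2 is integrable and that its
    integral is 2 (nu - k_j) times that of p q^2; the former is the squared norm of
    the Darboux transform of q, a solution at the level S_(j+1) with the same nu.
    Since squared norms are nonnegative and the k_j increase to infinity, nu must be
    one of the k_j, that is a number outside S ([level_spectrum]); and then q is
    determined up to a factor ([level_unique]). For complex eps the same integration
    applied to the real and imaginary parts shows that eps is real
    ([complex_energy]). This replaces both the completeness of the eigenfunctions and
    the asymptotics of the solutions.

    _Regularity_. An eigenfunction only satisfies the equation almost everywhere, with
    an absolutely continuous derivative. A covering argument shows that this
    derivative is continuously differentiable ([abs_cont_derive_ae],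
    [abs_cont_classical]). *)

(** * Determinants and Wronskians *)

Section Determinants.
Variable D : idomainType.

Lemma det_mx22 (M : 'M[D]_2) : \det M = M 0 0 * M 1 1 - M 0 1 * M 1 0.
Proof.
rewrite (expand_det_row _ 0) !big_ord_recl big_ord0 addr0 /cofactor !det_mx11.
rewrite !mxE /= mul1r expr1 mulN1r mulrN.
by congr (_ * M _ _ - M _ _ * M _ _); apply: val_inj.
Qed.

(** The Schur complement formula with the adjugate in place of the inverse, so that
    it holds over a ring of polynomials. *)
Lemma det_schur n k (A : 'M[D]_n) (B : 'M[D]_(n, k)) (C : 'M[D]_(k, n)) (E : 'M[D]_k) :
  \det A != 0 ->
  \det A ^+ k * \det (block_mx A B C E) =
  \det A * \det (\det A *: E - C *m \adj A *m B).
Proof.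
set d := \det A => d0.
have adjE : d * \det (\adj A) = d ^+ n.
  by rewrite -det_mulmx mul_mx_adj det_scalar.
have : block_mx A B C E *m block_mx (\adj A) (- (\adj A *m B)) 0 (d%:M) =
       block_mx (d%:M) 0 (C *m \adj A) (d *: E - C *m \adj A *m B).
  rewrite mulmx_block !mulmx0 !addr0 mul_mx_adj mulmxN mulmxA mul_mx_adj.
  rewrite mul_mx_scalar mul_scalar_mx addNr.
  by rewrite mulmxN mulmxA mul_mx_scalar addrC.
move/(congr1 (fun M => d * \det M)).
rewrite det_mulmx det_ublock det_lblock !det_scalar mulrCA (mulrA d) adjE => e.
apply: (mulfI (expf_neq0 n d0)).
rewrite mulrA mulrC -[RHS]mulrCA.
by rewrite -e; ring.
Qed.

Lemma det_bordered n (A : 'M[D]_n) (b : 'cV[D]_n) (c : 'rV[D]_n) (e : 'M[D]_1) :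
  \det A != 0 ->
  \det (block_mx A b c e) = \det A * e 0 0 - (c *m \adj A *m b) 0 0.
Proof.
move=> d0; apply: (mulfI d0); rewrite -[X in X * \det _]expr1 det_schur //.
by rewrite det_mx11 !mxE.
Qed.

(** The Desnanot-Jacobi identity. By [det_schur] each determinant is, up to powers of
    [\det A], that of a Schur complement of the corner [A]; for Schur complements
    the identity is the expansion of a 2 x 2 determinant. *)
Lemma det_jacobi n (A : 'M[D]_n) (B : 'M[D]_(n, 2)) (C : 'M[D]_(2, n)) (E : 'M[D]_2) :
  \det A != 0 ->
  let m i j := \det (block_mx A (col j B) (row i C) (E i j)%:M : 'M[D]_(n + 1)) in
  \det A * \det (block_mx A B C E) = m 0 0 * m 1 1 - m 0 1 * m 1 0.
Proof.
move=> d0 m.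
have mE i j : m i j = (\det A *: E - C *m \adj A *m B) i j.
  have e : (row i C *m \adj A *m col j B) 0 0 = (C *m \adj A *m B) i j.
    by rewrite -row_mul [LHS]mxE [RHS]mxE; apply: eq_bigr => t _; rewrite !mxE.
  by rewrite /m det_bordered // e !mxE eqxx mulr1n.
apply: (mulfI d0); rewrite mulrA -expr2 det_schur // det_mx22 -!mE.
by [].
Qed.

End Determinants.

Lemma deriv_bigprod (A : comNzRingType) (n : nat) (F : 'I_n -> {poly A}) :
  (\prod_(i < n) F i)^`() =
  \sum_(k < n) \prod_(i < n) (if i == k then (F i)^`() else F i).
Proof.
elim: n F => [|n IH] F; first by rewrite !big_ord0 derivC.
rewrite big_ord_recr /= derivM IH big_ord_recr /= mulr_suml; congr (_ + _).
  apply: eq_bigr => k _; rewrite big_ord_recr /=.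
  rewrite -val_eqE /= [n == _]gtn_eqF ?ltn_ord //.
rewrite big_ord_recr /= eqxx; congr (_ * _); apply: eq_bigr => i _.
by rewrite -val_eqE /= ltn_eqF.
Qed.

Lemma deriv_det (A : comNzRingType) n (M : 'M[{poly A}]_n) :
  (\det M)^`() =
  \sum_(k < n) \det (\matrix_(i, j) if i == k then (M i j)^`() else M i j).
Proof.
rewrite /determinant exchange_big /= raddf_sum; apply: eq_bigr => s _.
have -> : (-1) ^+ s = ((-1) ^+ s)%:P :> {poly A} by rewrite rmorphXn rmorphN1.
rewrite [LHS]derivM derivC mul0r add0r deriv_bigprod mulr_sumr.
by apply: eq_bigr => k _; congr (_ * _); apply: eq_bigr => i _; rewrite !mxE.
Qed.

Section Wronskian.
Variable R : realType.
Implicit Types (s : seq {poly R}) (g h : {poly R}).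

Lemma wronskian_nil : wronskian (R := R) [::] = 1.
Proof. exact: det_mx00. Qed.

Let corner s := \matrix_(i < size s, j < size s) (s`_j)^`(i) : 'M[{poly R}]_(size s).
Let bcol s g := \matrix_(i < size s, j < 1) g^`(i) : 'M[{poly R}]_(size s, 1).
Let brow s k := \matrix_(i < 1, j < size s) (s`_j)^`(k) : 'M[{poly R}]_(1, size s).

Lemma wronskian_size n s : size s = n ->
  wronskian s = \det (\matrix_(i < n, j < n) (s`_j)^`(i)).
Proof. by move=> <-. Qed.

Lemma wronskian_rcons s g :
  wronskian (rcons s g) =
  \det (block_mx (corner s) (bcol s g) (brow s (size s)) (g^`(size s))%:M).
Proof.
rewrite (@wronskian_size (size s + 1)) ?size_rcons ?addn1 //; congr (\det _).
apply/matrixP => i j; rewrite !mxE.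
case: splitP => i' /= ->; rewrite !mxE; case: splitP => j' /= ->;
  by rewrite !mxE ?ord1 ?addn0 nth_rcons ?ltn_ord ?ltnn ?eqxx ?mulr1n.
Qed.

Lemma det_matrix_addn1 (A : comNzRingType) n (F : nat -> nat -> A) :
  \det (\matrix_(i < n.+1, j < n.+1) F i j) =
  \det (\matrix_(i < n + 1, j < n + 1) F i j).
Proof. by rewrite addn1. Qed.

(** When a Wronskian is differentiated row by row, all terms but the last have two
    equal consecutive rows. *)
Lemma deriv_wronskian_rcons s g :
  (wronskian (rcons s g))^`() =
  \det (block_mx (corner s) (bcol s g) (brow s (size s).+1) (g^`((size s).+1))%:M).
Proof.
rewrite (@wronskian_size (size s).+1) ?size_rcons // deriv_det big_ord_recr /=.
rewrite big1 ?add0r => [|k _].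
  pose F i j := if i == size s then ((rcons s g)`_j)^`(i.+1) else ((rcons s g)`_j)^`(i).
  transitivity (\det (\matrix_(i < (size s).+1, j < (size s).+1) F i j)).
    by congr (\det _); apply/matrixP => i j; rewrite !mxE /F -derivnS -val_eqE.
  rewrite det_matrix_addn1; congr (\det _).
  apply/matrixP => i j; rewrite !mxE /F.
  case: splitP => i' /= ->; rewrite !mxE; case: splitP => j' /= ->;
    rewrite !mxE ?ord1 ?addn0 nth_rcons ?(ltn_eqF (ltn_ord _)) ?ltn_ord ?ltnn ?eqxx ?mulr1n //.
apply: (@determinant_alternate _ _ _ (widen_ord (leqnSn _) k) (lift ord0 k)).
  by rewrite -val_eqE /= neq_ltn ltnSn.
move=> j; rewrite !mxE eqxx -derivnS -[_ == widen_ord _ k]val_eqE /= /bump leq0n add1n.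
by rewrite gtn_eqF.
Qed.

(** Differentiating [wronskian (rcons s g)] only affects its last row, so all four
    factors on the right are bordered minors of
    [wronskian (rcons (rcons s g) h)] with the same corner [wronskian s]. *)
Lemma wronskian_jacobi s g h : wronskian s != 0 ->
  wronskian s * wronskian (rcons (rcons s g) h) =
  wronskian (rcons s g) * (wronskian (rcons s h))^`()
  - wronskian (rcons s h) * (wronskian (rcons s g))^`().
Proof.
move=> s0; set n := size s.
pose B : 'M[{poly R}]_(n, 2) := \matrix_(i, j) (if j == 0 then g else h)^`(i).
pose C : 'M[{poly R}]_(2, n) := \matrix_(i, j) (s`_j)^`(if i == 0 then n else n.+1).
pose E : 'M[{poly R}]_2 :=
  \matrix_(i, j) (if j == 0 then g else h)^`(if i == 0 then n else n.+1).
have := @det_jacobi _ n (corner s) B C E s0.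
have rowC (i : 'I_2) : row i C = brow s (if i == 0 then n else n.+1).
  by apply/matrixP => a b; rewrite !mxE.
have colB (i : 'I_2) : col i B = bcol s (if i == 0 then g else h).
  by apply/matrixP => a b; rewrite !mxE.
rewrite /= !rowC !colB !mxE /= -!deriv_wronskian_rcons -!wronskian_rcons.
move=> <-; congr (_ * _).
rewrite (@wronskian_size (n + 2)) ?size_rcons ?addn2 //; congr (\det _).
apply/matrixP => i j; rewrite !mxE.
case: splitP => i' /= ->; rewrite !mxE; case: splitP => j' /= ->;
  rewrite !mxE ?nth_rcons ?size_rcons ?ltn_ord ?(ltn_trans (ltn_ord _)) //.
- by case: j' => [[|[|//]] lt] /=;
    rewrite ?addn0 ?addn1 -/n ?ltnSn ?ltnn ?eqxx.
- by case: i' => [[|[|//]] lt] /=; rewrite ?addn0 ?addn1.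
- by case: j' => [[|[|//]] lt] /=; case: i' => [[|[|//]] lt'] /=;
    rewrite ?addn0 ?addn1 -/n ?ltnSn ?ltnn ?eqxx.
Qed.
End Wronskian.

(** * Wronskians of Hermite polynomials *)

Section Hermite.
Variable R : realType.
Local Notation H := (@hermite R).
Implicit Types (f g : {poly R}) (S : seq nat).

Lemma hermiteS n : H n.+2 = 2%:P * 'X * H n.+1 - (2 * n.+1%:R)%:P * H n.
Proof. by []. Qed.

Lemma deriv_hermite n : (H n.+1)^`() = (2 * n.+1%:R)%:P * H n.
Proof.
suff [] : (H n.+1)^`() = (2 * n.+1%:R)%:P * H n /\
          (H n.+2)^`() = (2 * n.+2%:R)%:P * H n.+1 by [].
elim: n => [|n [IH1 IH2]].
  rewrite hermiteS /= !(derivB, derivM, derivC, derivX) !(polyCM, polyC1).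
  by split; rewrite !polyC_natr; ring.
split=> //; rewrite hermiteS derivB !derivM !derivC derivX IH1 IH2 hermiteS.
by rewrite !polyCM !polyC_natr -!natr1 ; ring.
Qed.

Lemma hermite_ode n : (H n)^`(2) = 2%:P * 'X * (H n)^`() - (2 * n%:R)%:P * H n.
Proof.
case: n => [|[|n]]; rewrite !derivnS derivn0.
- by rewrite derivC derivC mulr0 mulr0 mul0r subr0.
- by rewrite deriv_hermite derivM derivC /= derivC !polyCM !polyC_natr; ring.
rewrite deriv_hermite derivM derivC deriv_hermite (hermiteS n).
by rewrite !polyCM !polyC_natr -!natr1; ring.
Qed.

Lemma size_hermite n : size (H n) = n.+1.
Proof.
suff [] : size (H n) = n.+1 /\ size (H n.+1) = n.+2 by [].
have two0 : (2 : R) != 0 by rewrite pnatr_eq0.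
elim: n => [|n [IH1 IH2]].
  by rewrite size_poly1 /= mul_polyC size_scale // size_polyX.
split=> //; rewrite hermiteS -mulrA !mul_polyC size_polyDl.
  by rewrite size_scale // mulrC size_mulX ?IH2 // -size_poly_eq0 IH2.
rewrite size_polyN !size_scale ?mulf_neq0 ?pnatr_eq0 // IH1 mulrC.
by rewrite size_mulX ?IH2 // -size_poly_eq0 IH2.
Qed.

(** The operator ['X d/dX] multiplies the top coefficient by the degree. *)
Lemma size_XderivB f : f != 0 ->
  (size ('X * f^`() - ((size f).-1%:R)%:P * f)%R < size f)%N.
Proof.
move=> f0; have sf : (0 < size f)%N by rewrite size_poly_gt0.
rewrite -(prednK sf) ltnS; apply/leq_sizeP => j jf.
rewrite coefB coefXM coefCM.
case: j jf => [|j] jf.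
  by move: jf; rewrite leqn0 => /eqP ->; rewrite mul0r subr0.
rewrite coef_deriv /=; move: jf; rewrite leq_eqVlt => /orP[/eqP ->|jf].
  by rewrite -[in X in X - _]mulr_natl subrr.
have -> : f`_j.+1 = 0 by apply: nth_default; move: jf sf; case: (size f).
by rewrite mul0rn mulr0 subr0.
Qed.

(** By [size_XderivB] the top coefficient of ['X] times the Wronskian is the product
    of the leading coefficients by the difference of the degrees. *)
Lemma size_wr2 f g : f != 0 -> g != 0 -> size f != size g ->
  f * g^`() - g * f^`() != 0 /\
  ((size (f * g^`() - g * f^`())%R).+2 = size f + size g)%N.
Proof.
move=> f0 g0 fg; set w := _ - _.
have sf : (0 < size f)%N by rewrite size_poly_gt0.
have sg : (0 < size g)%N by rewrite size_poly_gt0.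
set a := (size f).-1; set b := (size g).-1.
have sM : (size (f * g)%R = (size f + size g).-1)%N := size_mul f0 g0.
pose c : R := b%:R - a%:R.
have c0 : c != 0.
  by rewrite subr_eq0 eqr_nat; move: fg sf sg; rewrite /a /b; lia.
have e : 'X * w = c *: (f * g) + (f * ('X * g^`() - (b%:R)%:P * g)
      - g * ('X * f^`() - (a%:R)%:P * f)).
  by rewrite /w /c -mul_polyC polyCB; ring.
have lt_s : (size (f * ('X * g^`() - (b%:R)%:P * g)
      - g * ('X * f^`() - (a%:R)%:P * f))%R < size (c *: (f * g)))%N.
  rewrite size_scale // sM.
  apply: leq_ltn_trans (size_polyD _ _) _; rewrite size_polyN gtn_max.
  have h1 : (size ('X * f^`() - (a%:R)%:P * f)%R < size f)%N := size_XderivB f0.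
  have h2 : (size ('X * g^`() - (b%:R)%:P * g)%R < size g)%N := size_XderivB g0.
  have h3 : (size (f * ('X * g^`() - (b%:R)%:P * g))%R <=
      (size f + size ('X * g^`() - (b%:R)%:P * g)%R).-1)%N := size_polyMleq _ _.
  have h4 : (size (g * ('X * f^`() - (a%:R)%:P * f))%R <=
      (size g + size ('X * f^`() - (a%:R)%:P * f)%R).-1)%N := size_polyMleq _ _.
  apply/andP; split.
    by apply: leq_ltn_trans h3 _; clear -h2 sf sg; lia.
  by apply: leq_ltn_trans h4 _; clear -h1 sf sg; lia.
have : size ('X * w) = size (f * g) by rewrite e size_polyDl ?lt_s // size_scale.
rewrite sM.
have [->|w0] := eqVneq w 0; first by rewrite mulr0 size_poly0 => h; exfalso; move: h sf sg; lia.
have sX : size ('X * w) = (size w).+1 by rewrite mulrC size_mulX.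
rewrite sX => h; split=> //.
by rewrite h prednK // addn_gt0 sf.
Qed.

Definition hW S : {poly R} := wronskian [seq H s | s <- S].

Lemma hW_nil : hW [::] = 1. Proof. exact: wronskian_nil. Qed.

Lemma hW1 k : hW [:: k] = H k.
Proof. by rewrite /hW /wronskian /= det_mx11 mxE. Qed.

Lemma hW_jacobi S j k : hW S != 0 ->
  hW S * hW (rcons (rcons S j) k) =
  hW (rcons S j) * (hW (rcons S k))^`() - hW (rcons S k) * (hW (rcons S j))^`().
Proof. by rewrite /hW !map_rcons; exact: wronskian_jacobi. Qed.

(** The degree is computed by [size_wr2] along [hW_jacobi]; it also shows that the
    next Wronskian is not identically zero, which [hW_jacobi] presupposes. *)
Lemma size_hW S : uniq S ->
  hW S != 0 /\ ((size (hW S)).-1 + 'C(size S, 2) = sumn S)%N.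
Proof.
move: {2}(size S).+1 (ltnSn (size S)) => n; elim: n S => // n IH S.
case/lastP: S => [|S k].
  by rewrite hW_nil size_poly1 oner_neq0.
case/lastP: S => [|S j].
  by rewrite /= hW1 -size_poly_eq0 size_hermite /= bin_small ?addn0.
rewrite !size_rcons => ltn; rewrite rcons_uniq => /andP[kS] uSj.
move: (uSj); rewrite rcons_uniq => /andP[jS uS].
have uSk : uniq (rcons S k).
  by rewrite rcons_uniq uS andbT; move: kS; rewrite mem_rcons inE negb_or => /andP[].
have [S0 dS] := IH S (ltnW ltn) uS.
have [] := IH (rcons S j) _ uSj; first by rewrite size_rcons.
have [] := IH (rcons S k) _ uSk; first by rewrite size_rcons.
rewrite !size_rcons !sumn_rcons => k0 dk j0 dj.
have kj : k != j by move: kS; rewrite mem_rcons inE negb_or => /andP[].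
have sk : (0 < size (hW (rcons S k)))%N by rewrite size_poly_gt0.
have sj : (0 < size (hW (rcons S j)))%N by rewrite size_poly_gt0.
have sS : (0 < size (hW S))%N by rewrite size_poly_gt0.
have [] := @size_wr2 (hW (rcons S j)) (hW (rcons S k)) j0 k0 _.
  apply: contraNneq kj => e; move: dk; rewrite -e dj => /addnI ->.
  exact: eqxx.
rewrite -hW_jacobi //.
have [->|w0] := eqVneq (hW (rcons (rcons S j) k)) 0; first by rewrite mulr0 eqxx.
move=> _; rewrite size_mul // => e; split=> //.
have s0 : (0 < size (hW (rcons (rcons S j) k)))%N by rewrite size_poly_gt0.
move: e dS dk dj s0 sk sj sS; rewrite !binS !bin1 !bin0.
move: (size (hW S)) (size (hW (rcons S j))) (size (hW (rcons S k)))
  (size (hW (rcons (rcons S j) k))) ('C(size S, 2)) (size S) (sumn S); clear.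
by lia.
Qed.

Lemma hW_neq0 S : uniq S -> hW S != 0.
Proof. by case/size_hW. Qed.

(** The bilinear form of the exceptional Hermite equation: [bil e P y = 0] is the
    equation for [y] with [eta = P], multiplied by [P]. *)
Definition bil (e : R) (P y : {poly R}) : {poly R} :=
  P * y^`(2) - 2%:P * P^`() * y^`() + P^`(2) * y
  - 2%:P * 'X * (P * y^`() - P^`() * y) + e%:P * P * y.

Lemma derivn2 f : f^`(2) = f^`()^`(). Proof. by []. Qed.

(** Differentiating the relation that defines [y1] and eliminating the second
    derivatives by the two equations leaves a first-order relation times [P0]. *)
Lemma darboux_adjoint (P0 P1 y y1 : {poly R}) (a b : R) : P0 != 0 ->
  P0 * y1 = P1 * y^`() - y * P1^`() ->
  bil a P0 P1 = 0 -> bil b P0 y = 0 ->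
  P0 * y1^`() - P0^`() * y1 = 2%:P * 'X * P0 * y1 - (b - a)%:P * P1 * y.
Proof.
move=> P00 J B1 B2; apply: (mulfI P00).
have J' : P0 * y1^`() = P1 * y^`(2) - y * P1^`(2) - P0^`() * y1.
  move/(congr1 (@deriv R)): J; rewrite derivB !derivM -!derivn2 => J.
  by apply: (addrI (P0^`() * y1)); rewrite J; ring.
move: B1 B2; rewrite /bil => B1 B2.
have : P0 * (P0 * y1^`() - P0^`() * y1) -
  P0 * (2%:P * 'X * P0 * y1 - (b - a)%:P * P1 * y) =
  P1 * (bil b P0 y) - y * (bil a P0 P1) .
  rewrite polyCB /bil mulrBr J'.
  have -> : P0 * (2%:P * 'X * P0 * y1 - (b%:P - a%:P) * P1 * y) =
   P0 * (2%:P * 'X * (P0 * y1) - (b%:P - a%:P) * P1 * y) by ring.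
  have -> : P0 * (P0^`() * y1) = P0^`() * (P0 * y1) by ring.
  have -> : P0 * (P1 * y^`(2) - y * P1^`(2) - P0^`() * y1) =
    P0 * (P1 * y^`(2) - y * P1^`(2)) - P0^`() * (P0 * y1) by ring.
  rewrite J; ring.
by rewrite /bil B1 B2 !mulr0 subr0 => /eqP; rewrite subr_eq0 => /eqP.
Qed.

(** The parameter drops by 2 because it has the form [2 (k - size S)] and [S] gains
    one element. *)
Lemma darboux_bil (P0 P1 y y1 : {poly R}) (a b : R) : P0 != 0 ->
  P0 * y1 = P1 * y^`() - y * P1^`() ->
  bil a P0 P1 = 0 -> bil b P0 y = 0 -> bil (b - 2) P1 y1 = 0.
Proof.
move=> P00 J B1 B2; have T := darboux_adjoint P00 J B1 B2.
apply: (mulfI P00); rewrite mulr0.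
have Z : P0 * y1^`(2) = P0^`(2) * y1 + 2%:P * P0 * y1
    + 2%:P * 'X * (P0^`() * y1 + P0 * y1^`())
    - (b - a)%:P * (P1^`() * y + P1 * y^`()).
  move/(congr1 (@deriv R)): T.
  rewrite !(derivB, derivM, derivC, derivX) -!derivn2 => T.
  have -> : P0 * y1^`(2) = P0^`() * y1^`() + P0 * y1^`(2)
     - (P0^`(2) * y1 + P0^`() * y1^`()) + P0^`(2) * y1 by ring.
  by rewrite T; ring.
have -> : P0 * bil (b - 2) P1 y1 =
    P1 * (P0 * y1^`(2) - (P0^`(2) * y1 + 2%:P * P0 * y1
      + 2%:P * 'X * (P0^`() * y1 + P0 * y1^`())
      - (b - a)%:P * (P1^`() * y + P1 * y^`())))
    - 2%:P * P1^`() * (P0 * y1^`() - P0^`() * y1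
       - (2%:P * 'X * P0 * y1 - (b - a)%:P * P1 * y))
    + (b - a)%:P * P1 * (P0 * y1 - (P1 * y^`() - y * P1^`()))
    + y1 * bil a P0 P1.
  by rewrite /bil !polyCB; ring.
by rewrite Z T J B1 !subrr !mulr0 subr0 !addr0.
Qed.

(** The exceptional Hermite equation, by adding the indices one at a time: each
    addition is a Darboux transformation. *)
Lemma hW_bil S k : uniq S ->
  bil (2 * (k%:R - (size S)%:R)) (hW S) (hW (rcons S k)) = 0.
Proof.
elim/last_ind: S k => [|S j IH] k.
  move=> _; rewrite hW_nil hW1 /bil hermite_ode derivn2 !derivC subr0.
  by rewrite !polyCM !polyC_natr; ring.
move=> uSj; have := uSj; rewrite rcons_uniq => /andP[jS uS].
have S0 := hW_neq0 uS.
have := darboux_bil S0 (hW_jacobi j k S0) (IH j uS) (IH k uS).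
by rewrite size_rcons -natr1; congr (bil _ _ _ = 0); ring.
Qed.

(** The adjoint first-order relation: together with [hW_jacobi] it gives a pair of
    Darboux maps between the levels [S] and [rcons S j], inverse to each other up to
    the factor [2 (k - j)]. *)
Lemma hW_darboux S j k : uniq S ->
  hW S * (hW (rcons (rcons S j) k))^`() - (hW S)^`() * hW (rcons (rcons S j) k) =
  2%:P * 'X * hW S * hW (rcons (rcons S j) k)
  - (2 * (k%:R - j%:R))%:P * hW (rcons S j) * hW (rcons S k).
Proof.
move=> uS; have S0 := hW_neq0 uS.
rewrite (darboux_adjoint S0 (hW_jacobi j k S0) (hW_bil j uS) (hW_bil k uS)).
by congr (_ - _%:P * _ * _); ring.
Qed.

(** * Reduction of the norms to the Gaussian integral *)

(** [gauss_num F G / G ^ 2] is [U' - 2 x U] for [U = F / G], that is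
    [e^(x^2) (U e^(-x^2))']. *)
Definition gauss_num (F G : {poly R}) := F^`() * G - F * G^`() - 2%:P * 'X * F * G.

(** The functions [A / B e^(-x^2)] and [c e^(-x^2)] differ by the derivative of
    [U e^(-x^2)] for some rational function [U = F / G]. *)
Definition gauss_cohom (A B : {poly R}) (c : R) :=
  exists F G, G != 0 /\ (A - c%:P * B) * G ^+ 2 = B * gauss_num F G.

(** The two Darboux relations give
    [(y y1 / (P0 P1) e^(-x^2))' = (y1^2 / P1^2 - k y^2 / P0^2) e^(-x^2)]. *)
Lemma gauss_cohom_darboux (P0 P1 y y1 : {poly R}) (k c : R) : P0 != 0 -> P1 != 0 ->
  P0 * y1 = P1 * y^`() - y * P1^`() ->
  P0 * y1^`() - P0^`() * y1 = 2%:P * 'X * P0 * y1 - k%:P * P1 * y ->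
  gauss_cohom (y ^+ 2) (P0 ^+ 2) c -> gauss_cohom (y1 ^+ 2) (P1 ^+ 2) (k * c).
Proof.
move=> P00 P10 J T [F [G [G0 e]]].
exists (k%:P * F * (P0 * P1) + y * y1 * G), (G * (P0 * P1)).
split; first by rewrite !mulf_neq0.
have D : gauss_num (y * y1) (P0 * P1) = y1 ^+ 2 * P0 ^+ 2 - k%:P * y ^+ 2 * P1 ^+ 2.
  have -> : gauss_num (y * y1) (P0 * P1) =
    P0 * y1 * (P1 * y^`() - y * P1^`()) +
    P1 * y * (P0 * y1^`() - P0^`() * y1 - 2%:P * 'X * P0 * y1).
    by rewrite /gauss_num !derivM; ring.
  by rewrite -J T; ring.
have -> : gauss_num (k%:P * F * (P0 * P1) + y * y1 * G) (G * (P0 * P1)) =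
   k%:P * (P0 * P1) ^+ 2 * gauss_num F G + G ^+ 2 * gauss_num (y * y1) (P0 * P1).
  by rewrite /gauss_num !(derivD, derivM, derivC); ring.
have -> : P1 ^+ 2 * (k%:P * (P0 * P1) ^+ 2 * gauss_num F G + G ^+ 2 * gauss_num (y * y1) (P0 * P1))
  = k%:P * P1 ^+ 4 * (P0 ^+ 2 * gauss_num F G) + G ^+ 2 * P1 ^+ 2 * gauss_num (y * y1) (P0 * P1).
  by ring.
by rewrite -e D polyCM; ring.
Qed.

(** Here
    [(H_k H_(k+1) e^(-x^2))' = (2 (k + 1) H_k^2 - H_(k+1)^2) e^(-x^2)]. *)
Lemma gauss_cohom_hermite k : gauss_cohom (H k ^+ 2) 1 (2 ^+ k * k`!%:R).
Proof.
elim: k => [|k [F [G [G0 e]]]].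
  exists 0, 1; split; first exact: oner_neq0.
  by rewrite /gauss_num /= fact0 expr0 mul1r linear0 polyC1; ring.
pose c : R := 2 * k.+1%:R.
exists (c%:P * F - H k * H k.+1 * G), G; split=> //.
have -> : gauss_num (c%:P * F - H k * H k.+1 * G) G =
  c%:P * gauss_num F G - G ^+ 2 * gauss_num (H k * H k.+1) 1.
  by rewrite /gauss_num !(derivB, derivM, derivC); ring.
rewrite mul1r; move: e; rewrite mul1r => <-.
have hk : (H k)^`() = 2%:P * 'X * H k - H k.+1.
  case: (k) => [|n]; first by rewrite /= derivC; ring.
  by rewrite deriv_hermite hermiteS; ring.
have -> : gauss_num (H k * H k.+1) 1 = c%:P * H k ^+ 2 - H k.+1 ^+ 2.
  by rewrite /gauss_num derivM derivC hk deriv_hermite /c; ring.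
have -> : 2 ^+ k.+1 * (k.+1)`!%:R = c * (2 ^+ k * k`!%:R) :> R.
  by rewrite /c exprS factS natrM; ring.
by rewrite [(c * _)%:P]polyCM; ring.
Qed.

(** The sets [S] on the way may have Wronskians with real zeros: the statement is
    about rational functions, whatever their poles. *)
Lemma gauss_cohom_hW S k : uniq S ->
  gauss_cohom (hW (rcons S k) ^+ 2) (hW S ^+ 2)
    ((\prod_(s <- S) (2 * (k%:R - s%:R))) * (2 ^+ k * k`!%:R)).
Proof.
elim/last_ind: S => [_|S j IH uSj].
  by rewrite hW_nil hW1 big_nil mul1r expr1n; exact: gauss_cohom_hermite.
have := uSj; rewrite rcons_uniq => /andP[jS uS].
have S0 := hW_neq0 uS.
have := gauss_cohom_darboux S0 (hW_neq0 uSj) (hW_jacobi j k S0) (hW_darboux j k uS) (IH uS).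
by congr (gauss_cohom _ _ _); rewrite big_rcons /=; ring.
Qed.

End Hermite.

(** * The Krein-Adler condition *)

Section Adler.
Implicit Types S : seq nat.

Lemma exists_notin S : exists n, n \notin S.
Proof.
exists (\max_(s <- S) s).+1; apply/negP => /(@leq_bigmax_seq _ S xpredT id _).
by rewrite ltnn => /(_ isT).
Qed.

Definition mex S := ex_minn (exists_notin S).

Lemma mex_notin S : mex S \notin S.
Proof. by rewrite /mex; case: ex_minnP. Qed.

Lemma mem_lt_mex S i : (i < mex S)%N -> i \in S.
Proof.
rewrite /mex; case: ex_minnP => m _ min_m; apply: contraTT => /min_m.
by rewrite leqNgt.
Qed.

(** The Krein-Adler condition that [k - s], over [s] in [S], has a nonnegative
    product for every natural number [k], expressed as a parity. *)
Definition adler S :=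
  uniq S /\ forall k, k \notin S -> ~~ odd (count (fun s => k < s)%N S).

Lemma gt_mex S k : k \notin rcons S (mex S) -> (mex S < k)%N.
Proof.
rewrite mem_rcons inE negb_or => /andP[km kS].
rewrite ltn_neqAle eq_sym km /= leqNgt.
by apply: contra kS; exact: mem_lt_mex.
Qed.

Lemma mex_rcons S : (mex S < mex (rcons S (mex S)))%N.
Proof. exact: gt_mex (mex_notin _). Qed.

Lemma adler_rcons S : adler S -> adler (rcons S (mex S)).
Proof.
move=> [uS aS]; split; first by rewrite rcons_uniq mex_notin.
move=> k kS; have mk := gt_mex kS.
rewrite -cats1 count_cat /= (ltnNge k) (ltnW mk) /= !addn0; apply: aS.
by move: kS; rewrite mem_rcons inE negb_or => /andP[].
Qed.

Lemma count_lt_mex S : uniq S -> perm_eq [seq s <- S | (s < mex S)%N] (iota 0 (mex S)).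
Proof.
move=> uS; apply: uniq_perm; rewrite ?filter_uniq ?iota_uniq // => i.
rewrite mem_filter mem_iota /= add0n andb_idr //; exact: mem_lt_mex.
Qed.

Lemma size_mex S : uniq S ->
  (mex S + count (fun s => mex S < s)%N S)%N = size S.
Proof.
move=> uS; rewrite -(count_predC (fun s => s < mex S)%N S).
rewrite -[count (fun s => s < mex S)%N S]size_filter (perm_size (count_lt_mex uS)) size_iota; congr (_ + _)%N.
apply: eq_in_count => s sS /=; rewrite -leqNgt [RHS]leq_eqVlt.
by case: (mex S =P s) => // e; have := mex_notin S; rewrite e sS.
Qed.

End Adler.

Section AdlerDegree.
Variable R : realType.
Local Notation hW := (@hW R).
Implicit Types S : seq nat.

Lemma uniq_rcons_mex S : uniq S -> uniq (rcons S (mex S)).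
Proof. by rewrite rcons_uniq mex_notin. Qed.

(** The number of indices below the least missing integer is that integer. Hence
    adding it lowers the degree by the number of indices above it. *)
Lemma size_hW_mex S : uniq S ->
  (size (hW (rcons S (mex S))) + count (fun s => mex S < s)%N S)%N = size (hW S).
Proof.
move=> uS; have [] := size_hW R (uniq_rcons_mex uS).
have [] := size_hW R uS; rewrite -!size_poly_gt0 size_rcons sumn_rcons binS bin1.
by have := size_mex uS; lia.
Qed.

(** The chain of additions ends here: the Wronskian of [H_0, ..., H_(m-1)] is
    constant. *)
Lemma size_hW_initial S : uniq S -> count (fun s => mex S < s)%N S = 0%N ->
  size (hW S) = 1%N.
Proof.
move=> uS c0; have := size_mex uS; rewrite c0 addn0 => mS.
have pS : perm_eq S (iota 0 (size S)).
  rewrite -mS; have := count_lt_mex uS.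
  rewrite (@eq_in_filter _ _ xpredT) ?filter_predT // => s sS /=.
  move/eqP: c0; rewrite -leqn0 leqNgt -has_count => /hasPn /(_ s sS).
  rewrite -leqNgt leq_eqVlt => /orP[/eqP e|//].
  by move: (mex_notin S); rewrite -e sS.
have [] := size_hW R uS; rewrite -size_poly_gt0 (perm_sumn pS).
rewrite -bin2_sum sumnE /index_iota subn0.
lia.
Qed.

(** Along the chain the degree decreases by even numbers, down to 0. *)
Lemma adler_odd_size S : adler S -> odd (size (hW S)).
Proof.
move: {2}(size (hW S)).+1 (ltnSn (size (hW S))) => n; elim: n S => // n IH S.
move=> sn aS; have [uS ev] := aS; have := size_hW_mex uS.
have [c0|c0] := posnP (count (fun s => mex S < s)%N S).
  by move=> _; rewrite size_hW_initial.
move=> e; rewrite -e oddD (negbTE (ev _ (mex_notin S))) addbF IH //.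
  by move: sn c0 e; lia.
exact: adler_rcons.
Qed.
End AdlerDegree.

(** * Poles and real zeros *)

Section Nodeless.
Variable R : realType.
Implicit Types P F G A B : {poly R}.

Definition nodeless P := forall x, P.[x] != 0.

Lemma nodeless_neq0 P : nodeless P -> P != 0.
Proof. by move=> /(_ 0); apply: contraNneq => ->; rewrite horner0. Qed.

Lemma gauss_num_common_factor F G d : gauss_num (F * d) (G * d) = d ^+ 2 * gauss_num F G.
Proof. by rewrite /gauss_num !derivM; ring. Qed.

Lemma derivXsubCn (x : R) n :
  (('X - x%:P) ^+ n.+1)^`() = (n.+1%:R)%:P * ('X - x%:P) ^+ n.
Proof. by rewrite deriv_exp derivXsubC mul1r polyC_natr mulr_natl. Qed.

(** A derivative cannot lose a pole: in lowest terms, a zero of [G] of order [m] is a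
    pole of order [m + 1] of [(F / G e^(-x^2))'], while [A / B - c] has none. *)
Lemma gauss_cohom_regular A B c : nodeless B -> gauss_cohom A B c ->
  exists F G, nodeless G /\ (A - c%:P * B) * G ^+ 2 = B * gauss_num F G.
Proof.
move=> nB [F0 [G0 [nG0 e0]]].
set d := gcdp F0 G0.
have d0 : d != 0 by rewrite gcdp_eq0 negb_and nG0 orbT.
pose F := F0 %/ d; pose G := G0 %/ d.
have FE : F0 = F * d by rewrite divpK ?dvdp_gcdl.
have GE : G0 = G * d by rewrite divpK ?dvdp_gcdr.
have cFG : coprimep F G by apply: coprimep_div_gcd; rewrite nG0 orbT.
have G00 : G != 0 by apply: contraNneq nG0 => e; rewrite GE e mul0r.
have e : (A - c%:P * B) * G ^+ 2 = B * gauss_num F G.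
  apply: (mulfI (expf_neq0 2 d0)).
  rewrite mulrCA -exprMn (mulrC d) -GE e0 FE {1}GE gauss_num_common_factor; ring.
exists F, G; split=> // x; apply/negP => /eqP Gx.
have Fx : F.[x] != 0.
  by apply: (coprimep_root (p := G)); [rewrite coprimep_sym|apply/rootP].
have [m [Q Qx GQ]] := multiplicity_XsubC G x.
move: Qx; rewrite G00 /= => Qx.
have Y0 n : ('X - x%:P) ^+ n != 0 :> {poly R} by rewrite expf_neq0 // polyXsubC_eq0.
case: m GQ => [|m] GQ.
  by move: Qx; rewrite rootE; rewrite GQ expr0 mulr1 in Gx; rewrite Gx eqxx.
have : exists Z, Z * ('X - x%:P) =
   B * ((F^`() * Q - F * Q^`() - 2%:P * 'X * F * Q) * ('X - x%:P) - (m.+1%:R)%:P * F * Q).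
  exists ((A - c%:P * B) * Q ^+ 2 * ('X - x%:P) ^+ m.+1); apply: (mulfI (Y0 m)).
  have -> : ('X - x%:P) ^+ m * ((A - c%:P * B) * Q ^+ 2 * ('X - x%:P) ^+ m.+1 * ('X - x%:P)) =
    (A - c%:P * B) * G ^+ 2 by rewrite GQ !exprS; ring.
  rewrite e GQ /gauss_num derivM derivXsubCn !exprS; ring.
case=> Z /(congr1 (fun p => p.[x])); rewrite !hornerE subrr !mulr0.
rewrite sub0r => /esym/eqP.
rewrite !mulf_eq0 oppr_eq0 !mulf_eq0 (negbTE (nB x)) (negbTE Fx) pnatr_eq0 /=.
by move: Qx; rewrite rootE => /negbTE ->.
Qed.

(** A nonzero solution of a second-order linear equation has only simple zeros where
    the leading coefficient, here [P1], does not vanish. *)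
Lemma bil_simple_root e P0 P1 x : P0 != 0 -> bil e P0 P1 = 0 -> P1.[x] != 0 ->
  P0.[x] = 0 -> P0^`().[x] != 0.
Proof.
move=> P00 B1 P1x P0x; apply/negP => /eqP P0'x.
have [m [Q Qx PQ]] := multiplicity_XsubC P0 x.
move: Qx; rewrite P00 /= rootE => Qx.
have Y0 n : ('X - x%:P) ^+ n != 0 :> {poly R} by rewrite expf_neq0 // polyXsubC_eq0.
case: m PQ => [|[|m]] PQ.
- by move: P0x; rewrite PQ expr0 mulr1 => /eqP; rewrite (negbTE Qx).
- move: P0'x; rewrite PQ expr1 derivM derivXsubC !hornerE subrr mulr0 add0r.
  by move=> /eqP; rewrite (negbTE Qx).
have d1 : P0^`() = (Q^`() * ('X - x%:P) + (m.+2%:R)%:P * Q) * ('X - x%:P) ^+ m.+1.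
  by rewrite PQ derivM derivXsubCn !exprS; ring.
have d2 : P0^`(2) = ((Q^`() * ('X - x%:P) + (m.+2%:R)%:P * Q)^`() * ('X - x%:P) +
     (m.+1%:R)%:P * (Q^`() * ('X - x%:P) + (m.+2%:R)%:P * Q)) * ('X - x%:P) ^+ m.
  rewrite derivn2 d1 derivM derivXsubCn.
  by set Z := Q^`() * _ + _; rewrite !exprS; ring.
have : (('X - x%:P) ^+ m) * (Q * (('X - x%:P) * ('X - x%:P)) * P1^`(2) - 2%:P *
    (Q^`() * ('X - x%:P) + (m.+2%:R)%:P * Q) * ('X - x%:P) * P1^`() +
    ((Q^`() * ('X - x%:P) + (m.+2%:R)%:P * Q)^`() * ('X - x%:P) +
     (m.+1%:R)%:P * (Q^`() * ('X - x%:P) + (m.+2%:R)%:P * Q)) * P1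
    - 2%:P * 'X * (Q * (('X - x%:P) * ('X - x%:P)) * P1^`() -
      (Q^`() * ('X - x%:P) + (m.+2%:R)%:P * Q) * ('X - x%:P) * P1)
    + e%:P * (Q * (('X - x%:P) * ('X - x%:P))) * P1) = bil e P0 P1.
  rewrite /bil d2 d1 PQ; set Z := Q^`() * _ + _.
  by rewrite !exprS; ring.
rewrite B1 => /eqP; rewrite mulf_eq0 (negbTE (Y0 _)) /= => /eqP.
move/(congr1 (fun p => p.[x])); rewrite !(hornerD, hornerM, hornerN, hornerC, hornerX).
rewrite subrr !(mulr0, mul0r, oppr0).
rewrite !(subr0, add0r, addr0, mulr0) => /eqP.
by rewrite !mulf_eq0 !pnatr_eq0 (negbTE Qx) (negbTE P1x).
Qed.

Lemma even_degree_second_root P x : P != 0 -> odd (size P) -> P.[x] = 0 ->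
  P^`().[x] != 0 -> exists2 y, y != x & P.[y] = 0.
Proof.
move=> P0 oP /eqP/factor_theorem [Q PQ] P'x.
have Q0 : Q != 0 by apply: contraNneq P0 => e; rewrite PQ e mul0r.
have [y /rootP Qy] : {y | root Q y}.
  apply: odd_poly_root; move: oP; rewrite PQ size_Mmonic ?monicXsubC // size_XsubC.
  by rewrite addn2 /= => ->.
exists y; last by rewrite PQ hornerM Qy mul0r.
apply: contraNneq P'x => e; rewrite PQ derivM derivXsubC !hornerE -e Qy subrr.
by rewrite mulr0 addr0.
Qed.

Definition flux_num P0 P2 := P0^`() * P2 - P0 * P2^`() + 2%:P * 'X * P0 * P2.

(** With [v = P0 e^(x^2) / P2] and [p = (P2 / P1) ^ 2 e^(-x^2)] this is the
    equation [(p v')' = (b - a + 2) p v], where [p v' = flux_num P0 P2 / P1 ^ 2]. *)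
Lemma flux_eq (a b : R) P0 P1 P2 : bil a P0 P1 = 0 -> bil b P1 P2 = 0 ->
  P1 * (flux_num P0 P2)^`() - 2%:P * P1^`() * flux_num P0 P2 =
  (b - a + 2)%:P * P0 * P1 * P2.
Proof.
move=> B0 B1; apply/eqP; rewrite -subr_eq0; apply/eqP.
transitivity (P2 * bil a P0 P1 - P0 * bil b P1 P2); last by rewrite B0 B1 !mulr0 subr0.
rewrite /bil /flux_num !(derivD, derivN, derivM, derivC, derivX) -!derivn2.
have -> : (b - a + 2)%:P = b%:P - a%:P + 2%:P :> {poly R} by rewrite -!(polyCD, polyCN).
by ring.
Qed.

End Nodeless.

(** * Calculus and integration on the line *)

Section Calculus.
Local Open Scope classical_set_scope.
Local Open Scope ring_scope.
Variable R : realType.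
Implicit Types (f g : R -> R) (x a b : R).

(** These rules are stated for functions given pointwise, as the explicit functions
    below are. *)
Lemma dvD f g x a b : is_derive x 1 f a -> is_derive x 1 g b ->
  is_derive x 1 (fun t => f t + g t) (a + b).
Proof. by move=> hf hg; exact: is_deriveD. Qed.

Lemma dvB f g x a b : is_derive x 1 f a -> is_derive x 1 g b ->
  is_derive x 1 (fun t => f t - g t) (a - b).
Proof. by move=> hf hg; exact: is_deriveB. Qed.

Lemma dvN f x a : is_derive x 1 f a -> is_derive x 1 (fun t => - f t) (- a).
Proof. by move=> hf; exact: is_deriveN. Qed.

Lemma dvM f g x a b : is_derive x 1 f a -> is_derive x 1 g b ->
  is_derive x 1 (fun t => f t * g t) (a * g x + f x * b).
Proof.
move=> hf hg; apply: is_derive_eq (is_deriveM hf hg) _.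
by rewrite /GRing.scale /= addrC mulrC.
Qed.

Lemma dvsq f x a : is_derive x 1 f a -> is_derive x 1 (fun t => f t ^+ 2) (2 * f x * a).
Proof. by move=> hf; apply: is_derive_eq (dvM hf hf) _; ring. Qed.

Lemma dvC x (c : R) : is_derive x 1 (fun=> c) 0.
Proof. exact: is_derive_cst. Qed.

Lemma dvid x : is_derive x 1 (fun t : R => t) 1.
Proof. exact: is_derive_id. Qed.

Lemma dvZ f x (c a : R) : is_derive x 1 f a -> is_derive x 1 (fun t => c * f t) (c * a).
Proof.
by move=> hf; apply: is_derive_eq (dvM (dvC x c) hf) _; rewrite mul0r add0r.
Qed.

Lemma dvV f x a : f x != 0 -> is_derive x 1 f a ->
  is_derive x 1 (fun t => (f t)^-1) (- a / f x ^+ 2).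
Proof.
move=> fx hf; apply: is_derive_eq (is_deriveV fx hf) _.
by rewrite /GRing.scale /= mulrC mulrN mulNr.
Qed.

Lemma dvdiv f g x a b : g x != 0 -> is_derive x 1 f a -> is_derive x 1 g b ->
  is_derive x 1 (fun t => f t / g t) ((a * g x - f x * b) / g x ^+ 2).
Proof.
move=> gx hf hg; apply: is_derive_eq (dvM hf (dvV gx hg)) _.
by field.
Qed.

Lemma dvexp f x a : is_derive x 1 f a ->
  is_derive x 1 (fun t => expR (f t)) (a * expR (f x)).
Proof.
move=> hf; apply: is_derive_eq (is_derive1_comp (is_derive_expR _) hf) _.
by rewrite mulrC.
Qed.

Lemma dvpoly (p : {poly R}) x : is_derive x 1 (fun t => p.[t]) p^`().[x].
Proof. exact: is_derive_poly. Qed.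

Lemma dvsqr x : is_derive x 1 (fun t : R => t ^+ 2) (2 * x).
Proof.
by apply: is_derive_eq (dvM (dvid x) (dvid x)) _; ring.
Qed.

Lemma dvgauss x : is_derive x 1 (fun t : R => expR (- t ^+ 2)) (- 2 * x * expR (- x ^+ 2)).
Proof.
by apply: is_derive_eq (dvexp (dvN (dvsqr x))) _; rewrite mulNr.
Qed.

Lemma dvcont f (df : R -> R) : (forall x, is_derive x 1 f (df x)) -> continuous f.
Proof.
move=> hf x; apply: differentiable_continuous.
by apply/derivable1_diffP; apply: ex_derive.
Qed.

Lemma ctD f g : continuous f -> continuous g -> continuous (fun x => f x + g x).
Proof. by move=> cf cg x; apply: cvgD; [exact: cf|exact: cg]. Qed.

Lemma ctB f g : continuous f -> continuous g -> continuous (fun x => f x - g x).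
Proof. by move=> cf cg x; apply: cvgB; [exact: cf|exact: cg]. Qed.

Lemma ctM f g : continuous f -> continuous g -> continuous (fun x => f x * g x).
Proof. by move=> cf cg x; apply: cvgM; [exact: cf|exact: cg]. Qed.

Lemma ctC (c : R) : continuous (fun _ : R => c).
Proof. by move=> x; exact: cvg_cst. Qed.

Lemma ctV f : (forall x, f x != 0) -> continuous f -> continuous (fun x => (f x)^-1).
Proof. by move=> f0 cf x; apply: cvgV => //; exact: cf. Qed.

Lemma ctpoly (p : {poly R}) : continuous (fun x => p.[x]).
Proof. exact: dvcont (dvpoly p). Qed.

Lemma ctgauss : continuous (fun x : R => expR (- x ^+ 2)).
Proof. exact: dvcont dvgauss. Qed.

Lemma ctmeas f (D : set R) : continuous f -> measurable D -> measurable_fun D f.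
Proof.
by move=> cf mD; apply: measurable_funTS; exact: continuous_measurable_fun.
Qed.

End Calculus.

Section Integrals.
Local Open Scope classical_set_scope.
Local Open Scope ring_scope.
Variable R : realType.
Local Notation mu := (@lebesgue_measure R).
Implicit Types (f g : R -> R) (x a b : R).

Lemma ct_integrable f a b : continuous f -> mu.-integrable `[a, b] (EFin \o f).
Proof.
move=> cf; apply: continuous_compact_integrable; first exact: segment_compact.
exact: continuous_subspaceT.
Qed.

Lemma FTC f (df : R -> R) a b : a < b -> (forall x, is_derive x 1 f (df x)) ->
  continuous df -> (\int[mu]_(x in `[a, b]) (df x)%:E = (f b - f a)%:E)%E.
Proof.
move=> ab hf cdf; rewrite (@continuous_FTC2 _ df f) //.
- exact: continuous_subspaceT.
- have cf := dvcont hf; split.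
  + by move=> x _; exact: ex_derive.
  + exact: cvg_at_right_filter (cf a).
  + exact: cvg_at_left_filter (cf b).
- by move=> x _; rewrite derive1E; exact: derive_val.
Qed.

(** This cutoff vanishes at both ends of the interval [- n - 1, n + 1], so that
    integration by parts there leaves no boundary terms, and its derivative is
    at most [2 / (n + 1)] in absolute value. *)
Definition cut (n : nat) x : R := 1 - x ^+ 2 * (n.+1%:R ^- 2).

Lemma dvcut n x : is_derive x 1 (cut n) (- (2 * x * (n.+1%:R ^- 2))).
Proof.
apply: is_derive_eq (dvB (dvC x 1) (dvM (dvsqr x) (dvC x _))) _.
by rewrite mulr0 addr0 sub0r.
Qed.

Lemma cut_end n : cut n n.+1%:R = 0 /\ cut n (- n.+1%:R) = 0.
Proof.
have n0 : (n.+1%:R : R) != 0 by rewrite pnatr_eq0.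
by rewrite /cut sqrrN divff ?expf_neq0 // subrr.
Qed.

Lemma cut_bounds n x : `|x| <= n.+1%:R ->
  [/\ 0 <= cut n x, cut n x <= 1 & `|2 * x * (n.+1%:R ^- 2)| <= 2].
Proof.
move=> xn; have n1 : (1 : R) <= n.+1%:R by rewrite ler1n.
have n0 : (0 : R) < n.+1%:R by rewrite ltr0n.
have h0 : 0 <= x ^+ 2 * n.+1%:R ^- 2.
  by rewrite mulr_ge0 ?sqr_ge0 // invr_ge0 exprn_ge0 // ltW.
have h1 : x ^+ 2 * n.+1%:R ^- 2 <= 1.
  rewrite ler_pdivrMr ?exprn_gt0 // mul1r -real_normK ?num_real //.
  by rewrite lerXn2r ?nnegrE // ltW.
rewrite /cut; split; [by rewrite subr_ge0|by rewrite gerBl|].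
rewrite 2!normrM ger0_norm // -mulrA ler_piMr //.
rewrite [X in _ * X]ger0_norm; last by rewrite invr_ge0 exprn_ge0 // ltW.
rewrite ler_pdivrMr ?exprn_gt0 // mul1r expr2 (le_trans xn) //.
by rewrite ler_peMl // ltW.
Qed.

(** Integrating [(cut n f)'] over the interval of the cutoff gives 0; by dominated
    convergence the limit is the integral of [df]. Integrability replaces any
    information on the behaviour of [f] at infinity. *)
Lemma integral_derive_eq0 (f df : R -> R) : (forall x, is_derive x 1 f (df x)) ->
  continuous df -> mu.-integrable setT (EFin \o f) ->
  mu.-integrable setT (EFin \o df) -> (\int[mu]_x (df x)%:E = 0)%E.
Proof.
move=> hf cdf If Idf; have cf := dvcont hf.
pose m n : R := n.+1%:R.
pose g n x := cut n x * df x - 2 * x * (m n ^- 2) * f x.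
pose I n := `[- m n, m n]%classic.
pose G n := (EFin \o g n) \_ (I n).
have m0 n : - m n < m n by have : 0 < m n := ltr0Sn _ n; lra.
have cg n : continuous (g n).
  apply: ctB; apply: ctM => //; first exact: dvcont (dvcut n).
  apply: ctM; last exact: ctC.
  by apply: ctM; [exact: ctC|move=> x; exact: cvg_id].
have IG n : (\int[mu]_x G n x = 0)%E.
  have hg x : is_derive x 1 (fun t => cut n t * f t) (g n x).
    by apply: is_derive_eq (dvM (dvcut n x) (hf x)) _; rewrite /g /m; ring.
  rewrite /G -integral_mkcond (FTC (m0 n) hg (cg n)).
  by have [e1 e2] := cut_end n; rewrite /m e1 e2 !mul0r subrr.
have [] := @dominated_convergence _ _ _ mu setT measurableT G (EFin \o df)
  (fun x => `|df x|%:E + 2%:E * `|f x|%:E)%E.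
- move=> n; apply/(measurable_restrictT (EFin \o g n)).
    exact: measurable_itv.
  by apply/measurable_EFinP; apply: ctmeas => //; exact: measurable_itv.
- by apply/measurable_EFinP; apply: ctmeas.
- apply: aeW => x _.
  have : (df x - (x ^+ 2 * df x + 2 * x * f x) * (harmonic n * harmonic n))%:E
      @[n --> \oo] --> (df x)%:E.
    apply: cvg_EFin; first exact: nearW.
    rewrite -[X in _ --> X]subr0; apply: cvgB; first exact: cvg_cst.
    rewrite -[0](mulr0 (x ^+ 2 * df x + 2 * x * f x)); apply: cvgM; first exact: cvg_cst.
    by rewrite -[0](mulr0 0); apply: cvgM; exact: cvg_harmonic.
  apply: cvg_trans; apply: near_eq_cvg.
  have [N xN] : exists N, `|x| <= N%:R.
    by exists (Num.bound `|x|); apply/ltW/archi_boundP.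
  near=> n.
  rewrite /G patchE mem_set; last first.
    rewrite /I /= in_itv /= -ler_norml (le_trans xN) // ler_nat.
    by apply: leqW; near: n; exact: nbhs_infty_ge.
  rewrite /g /cut /m /harmonic /=; congr EFin; field.
  by rewrite addrC natr1 pnatr_eq0.
- have Iadf := integrable_abse Idf; have Iaf := integrable_abse If.
  exact: (integrableD measurableT Iadf (integrableZl measurableT 2 Iaf)).
- apply: aeW => x n _; rewrite /G patchE.
  case: ifPn => [/set_mem|_]; last first.
    rewrite (_ : `|point|%E = 0%E :> \bar R); last exact: abse0.
    by rewrite -EFinM -EFinD lee_fin addr_ge0 ?mulr_ge0.
  rewrite /I /= in_itv /= -ler_norml => /cut_bounds [c0 c1 c2].
  rewrite lee_fin (le_trans (ler_normB _ _)) // !normrM lerD //.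
    by rewrite ler_piMl // ger0_norm.
  by rewrite -!normrM normrM ler_wpM2r.
move=> _ _ h; have e : (fun n => \int[mu]_x G n x)%E = cst 0%E by apply/funext => n.
by move: h; rewrite e => /(cvg_unique _ (cvg_cst _)) <-.
Unshelve. all: by end_near.
Qed.

Lemma le_add_of_sqr (u v w : R) : 0 <= v -> 0 <= w -> u ^+ 2 <= 4 * (v * w) ->
  `|u| <= v + w.
Proof.
move=> v0 w0 uvw; rewrite -ler_sqr ?nnegrE ?addr_ge0 //.
rewrite real_normK ?num_real // (le_trans uvw) // -subr_ge0.
have -> : (v + w) ^+ 2 - 4 * (v * w) = (v - w) ^+ 2 by ring.
exact: sqr_ge0.
Qed.

(** A Caccioppoli estimate: for [G = p q q'], [A = p q' ^ 2] and [B = p q ^ 2] the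
    hypothesis on the derivative of [G] is the equation [(p q')' = - k p q]. When
    the derivative of [cut ^ 2 G] is integrated, the term [2 cut cut' G] is
    absorbed by half of [cut ^ 2 A] and a multiple of [B]. *)
Lemma caccioppoli (G A B : R -> R) (k : R) : continuous A -> continuous B ->
  (forall x, 0 <= A x) -> (forall x, 0 <= B x) ->
  (forall x, is_derive x 1 G (A x - k * B x)) ->
  (forall x, G x ^+ 2 <= A x * B x) ->
  mu.-integrable setT (EFin \o B) -> mu.-integrable setT (EFin \o A).
Proof.
move=> cA cB A0 B0 hG GAB IB.
(* The 8 bounds [2 cut' ^ 2]. *)
pose c : R := `|k| + 8.
pose I n := `[- n.+1%:R : R, n.+1%:R]%classic.
have mI n : measurable (I n) by exact: measurable_itv.
have mA (D : set R) : measurable D -> measurable_fun D (EFin \o A).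
  by move=> mD; apply/measurable_EFinP; exact: ctmeas.
have mB (D : set R) : measurable D -> measurable_fun D (EFin \o B).
  by move=> mD; apply/measurable_EFinP; exact: ctmeas.
have IBfin : (\int[mu]_x (B x)%:E < +oo)%E.
  case/integrableP: IB => _; congr (_ < _)%E.
  by apply: eq_integral => x _ /=; rewrite ger0_norm.
have bound n : (\int[mu]_(x in I n) (A x)%:E <= (4 * c)%:E * \int[mu]_x (B x)%:E)%E.
  (* The cutoff of [- 2 n - 2, 2 n + 2] is at least 3 / 4 on [- n - 1, n + 1]. *)
  pose N := (n.*2).+1; pose m : R := N.+1%:R.
  pose t (x : R) := - (2 * x * (m ^- 2)).
  pose d x := 2 * cut N x * t x * G x + cut N x ^+ 2 * (A x - k * B x).
  have ccut := dvcont (dvcut N).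
  have cG := dvcont hG.
  have ct : continuous t.
    move=> x; apply: cvgN; apply: cvgM; last exact: cvg_cst.
    by apply: cvgM; [exact: cvg_cst|exact: cvg_id].
  have csq : continuous (fun x => cut N x ^+ 2) by exact: (ctM ccut ccut).
  have cd : continuous d.
    apply: ctD; last by apply: ctM => //; apply: ctB => //; apply: ctM => //; exact: ctC.
    apply: ctM => //; apply: ctM => //; apply: ctM => //; exact: ctC.
  have dvd x : is_derive x 1 (fun x => cut N x * cut N x * G x) (d x).
    apply: is_derive_eq (dvM (dvM (dvcut N x) (dvcut N x)) (hG x)) _.
    by rewrite /d /t /m; ring.
  have nn x : 0 <= 2 * 2 * (2^-1 * cut N x ^+ 2 * A x).
    have -> : 2 * 2 * (2^-1 * cut N x ^+ 2 * A x) = 2 * (cut N x ^+ 2 * A x) by field.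
    by rewrite mulr_ge0 // mulr_ge0 // sqr_ge0.
  have m0 : - m < m by have : 0 < m := ltr0Sn _ N; lra.
  have sub : I n `<=` I N.
    move=> x; rewrite /I /= !in_itv /= -!ler_norml => /le_trans; apply.
    by rewrite ler_nat ltnS /N -addnn; exact: leq_trans (leq_addr _ _) (leqnSn _).
  apply: (@le_trans _ _ (\int[mu]_(x in I n) (2 * 2 * (2^-1 * cut N x ^+ 2 * A x))%:E)%E).
    apply: (ge0_le_integral mu (mI n)).
    - by move=> x _; rewrite lee_fin.
    - exact: mA.
    - apply/measurable_EFinP; apply: ctmeas => //.
      apply: ctM; first exact: ctC.
      by apply: ctM => //; apply: ctM => //; exact: ctC.
    - move=> x; rewrite /I /= in_itv /= -ler_norml => xn; rewrite lee_fin.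
      have h : 3 / 4 <= cut N x.
        rewrite /cut; suff : x ^+ 2 * N.+1%:R ^- 2 <= 1 / 4.
          by move: (x ^+ 2 * _) => u; lra.
        have -> : (N.+1%:R : R) = 2 * n.+1%:R.
          by rewrite -natrM /N -mul2n; congr (_%:R); lia.
        have n0 : 0 < n.+1%:R :> R by rewrite ltr0n.
        rewrite ler_pdivrMr ?exprn_gt0 ?mulr_gt0 //.
        have : x ^+ 2 <= n.+1%:R ^+ 2.
          by rewrite -real_normK ?num_real // lerXn2r ?nnegrE // ltW.
        rewrite exprMn; lra.
      have -> : 2 * 2 * (2^-1 * cut N x ^+ 2 * A x) = 2 * cut N x ^+ 2 * A x by field.
      rewrite -[leLHS]mul1r ler_wpM2r //.
      have : (3 / 4) ^+ 2 <= cut N x ^+ 2 by rewrite lerXn2r ?nnegrE //; lra.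
      by lra.
  apply: (@le_trans _ _ (\int[mu]_(x in I N) (2 * 2 * (2^-1 * cut N x ^+ 2 * A x))%:E)%E).
    apply: (ge0_subset_integral mu (mI n) (mI N)) => //.
    - apply/measurable_EFinP; apply: ctmeas => //.
      apply: ctM; first exact: ctC.
      by apply: ctM => //; apply: ctM => //; exact: ctC.
    - by move=> x _; rewrite lee_fin; exact: nn.
  apply: (@le_trans _ _ (\int[mu]_(x in I N) (4 * d x + 4 * c * B x)%:E)%E).
    apply: (ge0_le_integral mu (mI N)).
    - by move=> x _; rewrite lee_fin; exact: nn.
    - apply/measurable_EFinP; apply: ctmeas => //.
      apply: ctM; first exact: ctC.
      by apply: ctM => //; apply: ctM => //; exact: ctC.
    - apply/measurable_EFinP; apply: ctmeas => //.
      by apply: ctD; apply: ctM => //; exact: ctC.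
    - move=> x; rewrite /I /= in_itv /= -ler_norml => /cut_bounds [c0 c1 t2].
      rewrite lee_fin.
      have t4 : t x ^+ 2 <= 4.
        have -> : (4 : R) = 2 ^+ 2 by ring.
        rewrite -real_normK ?num_real // lerXn2r ?nnegrE //.
        by rewrite /t normrN.
      have c21 : cut N x ^+ 2 <= 1 by rewrite exprn_ile1.
      have := @le_add_of_sqr (2 * cut N x * t x * G x)
         (2^-1 * cut N x ^+ 2 * A x) (2 * t x ^+ 2 * B x).
      have -> : 0 <= 2^-1 * cut N x ^+ 2 * A x.
        by rewrite mulr_ge0 // mulr_ge0 ?sqr_ge0 // invr_ge0.
      have -> : 0 <= 2 * t x ^+ 2 * B x.
        by rewrite mulr_ge0 // mulr_ge0 ?sqr_ge0.
      move=> /(_ isT isT).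
      have -> : (2 * cut N x * t x * G x) ^+ 2 =
         4 * (cut N x * t x) ^+ 2 * G x ^+ 2 by ring.
      have -> : 4 * (2^-1 * cut N x ^+ 2 * A x * (2 * t x ^+ 2 * B x)) =
        4 * (cut N x * t x) ^+ 2 * (A x * B x) by field.
      have -> : 4 * (cut N x * t x) ^+ 2 * G x ^+ 2 <= 4 * (cut N x * t x) ^+ 2 * (A x * B x).
        by rewrite ler_wpM2l // mulr_ge0 // sqr_ge0.
      move=> /(_ isT); rewrite ler_norml => /andP[h _].
      have hB : t x ^+ 2 * B x <= 4 * B x by rewrite ler_wpM2r.
      have hk : k * (cut N x ^+ 2 * B x) <= `|k| * B x.
        apply: (@le_trans _ _ (`|k| * (cut N x ^+ 2 * B x))).
          by rewrite ler_wpM2r ?ler_norm // mulr_ge0 ?sqr_ge0.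
        by rewrite ler_wpM2l // ler_piMl.
      move: h hB hk; rewrite /d /c.
      set a1 := cut N x ^+ 2 * A x; set b1 := cut N x ^+ 2 * B x.
      have -> : 2^-1 * cut N x ^+ 2 * A x = 2^-1 * a1 by rewrite /a1; ring.
      have -> : cut N x ^+ 2 * (A x - k * B x) = a1 - k * b1 by rewrite /a1 /b1; ring.
      have -> : 2 * t x ^+ 2 * B x = 2 * (t x ^+ 2 * B x) by ring.
      move: (2 * cut N x * t x * G x) => g h hB hk.
      have -> : 4 * (`|k| + 8) * B x = 4 * (`|k| * B x) + 32 * B x by ring.
      move: (k * b1) (`|k| * B x) (t x ^+ 2 * B x) h hB hk => u v w.
      lra.
  have -> : (\int[mu]_(x in I N) (4 * d x + 4 * c * B x)%:E =
     \int[mu]_(x in I N) (4 * d x)%:E + \int[mu]_(x in I N) (4 * c * B x)%:E)%E.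
    apply: (@integralD_EFin _ _ _ mu _ (mI N) (fun x => 4 * d x) (fun x => 4 * c * B x));
      by apply: ct_integrable; apply: ctM => //; exact: ctC.
  have -> : (\int[mu]_(x in I N) (4 * d x)%:E = 0)%E.
    have h x : is_derive x 1 (fun x => 4 * (cut N x * cut N x * G x)) (4 * d x).
      exact: dvZ.
    rewrite (FTC m0 h); last by apply: ctM => //; exact: ctC.
    by have [e1 e2] := cut_end N; rewrite /m e1 e2 !(mul0r, mulr0) subrr.
  rewrite add0e.
  have c0 : 0 <= 4 * c by rewrite mulr_ge0 // addr_ge0.
  under eq_integral do rewrite EFinM.
  rewrite (ge0_integralZl mu (mI N)) //; last 2 first.
  - exact: mB.
  - by move=> x _; rewrite lee_fin.
  rewrite lee_wpmul2l ?lee_fin //; apply: (ge0_subset_integral mu (mI N) measurableT) => //.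
  - exact: mB.
  - by move=> x _; rewrite lee_fin.
apply/integrableP; split; first exact: mA.
have -> : (\int[mu]_x `|(EFin \o A) x| = \int[mu]_x (A x)%:E)%E.
  by apply: eq_integral => x _ /=; rewrite ger0_norm.
have UI : \bigcup_n I n = setT.
  apply/seteqP; split=> // x _; exists (Num.bound `|x|) => //.
  rewrite /I /= in_itv /= -ler_norml ltW // (lt_trans (archi_boundP _)) // ltr_nat //.
apply: (@le_lt_trans _ _ ((4 * c)%:E * \int[mu]_x (B x)%:E)%E); last first.
  by rewrite lte_mul_pinfty // lee_fin mulr_ge0 // addr_ge0.
have cvgI : (\int[mu]_(x in I i) (A x)%:E @[i --> \oo] -->
    \int[mu]_(x in \bigcup_i I i) (A x)%:E)%E.
  apply: ge0_nondecreasing_set_cvg_integral.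
  - move=> a b ab; apply/subsetPset => x; rewrite /I /= !in_itv /= -!ler_norml.
    by move=> /le_trans; apply; rewrite ler_nat ltnS.
  - exact: mI.
  - by move=> i; exact: mA.
  - by move=> i x _; rewrite lee_fin.
by rewrite -UI; apply: cvge_to_le cvgI _; rewrite UI; exact: nearW.
Qed.

End Integrals.

(** * Gaussian integrals of rational functions *)

Section GaussianBounds.
Local Open Scope classical_set_scope.
Local Open Scope ring_scope.
Variable R : realType.
Local Notation mu := (@lebesgue_measure R).
Implicit Types (x : R) (A B F G P : {poly R}).

Lemma powX_le_expR n x : 0 <= x -> x ^+ n <= n`!%:R * expR x.
Proof.
case: n => [|n] x0; first by rewrite expr0 fact0 mul1r -[leLHS]expR0 ler_expR.
have f0 : 0 < n.+1`!%:R :> R by rewrite ltr0n fact_gt0.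
rewrite -ler_pdivrMl // mulrC; apply: le_trans (expR_ge1Dxn n x0).
by rewrite lerDr.
Qed.

Lemma powX_le_gauss n : exists c : R, forall x, `|x| ^+ n <= c * expR (x ^+ 2 / 2).
Proof.
exists (1 + 2 ^+ n * n`!%:R) => x.
have y0 : 0 <= x ^+ 2 / 2 by rewrite divr_ge0 ?sqr_ge0.
have e1 : 1 <= expR (x ^+ 2 / 2) by rewrite -[leLHS]expR0 ler_expR.
apply: (@le_trans _ _ (1 + `|x| ^+ n.*2)).
  have [x1|x1] := leP `|x| 1.
    by rewrite ler_wpDr ?exprn_ge0 // exprn_ile1.
  by rewrite ler_wpDl // ler_eXn2l // -addnn leq_addr.
rewrite mulrDl mul1r lerD // -mul2n exprM real_normK ?num_real //.
have -> : (x ^+ 2) ^+ n = 2 ^+ n * (x ^+ 2 / 2) ^+ n.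
  by rewrite -exprMn; congr (_ ^+ n); field.
by rewrite -mulrA ler_wpM2l ?exprn_ge0 // powX_le_expR.
Qed.

Lemma poly_le_gauss A : exists c : R, forall x, `|A.[x]| <= c * expR (x ^+ 2 / 2).
Proof.
elim/poly_ind: A => [|A a [c Hc]].
  by exists 0 => x; rewrite horner0 normr0 mul0r.
suff [c' Hc'] : exists c', forall x, `|A.[x] * x| <= c' * expR (x ^+ 2 / 2).
  exists (c' + `|a|) => x; rewrite !hornerE (le_trans (ler_normD _ _)) //.
  rewrite mulrDl lerD // ler_peMr // -[leLHS]expR0 ler_expR divr_ge0 ?sqr_ge0 //.
have {Hc}[n Hn] : exists n, forall x, `|A.[x]| <= (\sum_(i < n) `|A`_i|) * (1 + `|x| ^+ n).
  exists (size A) => x; rewrite horner_coef mulr_suml (le_trans (ler_norm_sum _ _ _)) //.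
  apply: ler_sum => i _; rewrite normrM normrX ler_wpM2l //.
  have [x1|x1] := leP `|x| 1; first by rewrite ler_wpDr ?exprn_ge0 // exprn_ile1.
  by rewrite ler_wpDl // ler_eXn2l // ltnW.
have [c1 H1] := powX_le_gauss 1; have [c2 H2] := powX_le_gauss n.+1.
exists ((\sum_(i < n) `|A`_i|) * (c1 + c2)) => x.
rewrite normrM (le_trans (ler_wpM2r _ (Hn x))) // -[leLHS]mulrA -[leRHS]mulrA.
rewrite ler_wpM2l ?sumr_ge0 //.
by rewrite mulrDl mul1r mulrDl -exprSr lerD //; exact: H1.
Qed.

(** Far out the squares of [B] and of its reflection exceed their leading
    coefficients; in between there is compactness. *)
Lemma nodeless_lower_bound B : nodeless B -> exists2 c : R, 0 < c & forall x, c <= `|B.[x]|.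
Proof.
move=> nB; have B0 := nodeless_neq0 nB.
have l0 : 0 < lead_coef (B ^+ 2).
  by rewrite lead_coef_exp exprn_even_gt0 // lead_coef_eq0.
have l1 : 0 < lead_coef ((B \Po - 'X) ^+ 2).
  rewrite lead_coef_exp exprn_even_gt0 // lead_coef_eq0.
  by rewrite comp_poly_eq0 ?size_polyN ?size_polyX.
have [a Ha] := poly_pinfty_gt_lc l0; have [b Hb] := poly_pinfty_gt_lc l1.
set u := lead_coef _ in l0 Ha; set v := lead_coef _ in l1 Hb.
pose m := `|a| + `|b|.
have cB : {within `[- m, m], continuous (fun x => B.[x] ^+ 2)}.
  apply: continuous_subspaceT.
  exact: (ctM (ctpoly (p := B)) (ctpoly (p := B))).
have m0 : - m <= m by have : 0 <= m; [rewrite addr_ge0|lra].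
have [t _ Ht] := EVT_min m0 cB.
pose w := B.[t] ^+ 2.
have w0 : 0 < w by rewrite exprn_even_gt0 //=; exact: nB.
pose c2 := Num.min w (Num.min u v).
have c20 : 0 < c2 by rewrite /c2 !lt_min w0 l0 l1.
exists (Num.sqrt c2); first by rewrite sqrtr_gt0.
move=> x; rewrite -ler_sqr ?nnegrE ?sqrtr_ge0 // sqr_sqrtr; last exact: ltW.
rewrite real_normK ?num_real // /c2 !ge_min.
have [x1|x1] := leP x m; last first.
  have : u <= (B ^+ 2).[x].
    by apply: Ha; rewrite (le_trans (ler_norm _)) // (le_trans _ (ltW x1)) // lerDl.
  by rewrite horner_exp => ->; rewrite orbT.
have [x2|x2] := leP (- m) x; first by rewrite Ht // in_itv /= x1 x2.
have : v <= ((B \Po - 'X) ^+ 2).[- x].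
  apply: Hb; rewrite (le_trans (ler_norm _)) // lerNr (le_trans (ltW x2)) //.
  by rewrite lerN2 lerDr.
by rewrite horner_exp horner_comp hornerN hornerX opprK => ->; rewrite !orbT.
Qed.

Lemma ratio_bound A B : nodeless B ->
  exists c : R, forall x, `|A.[x] / B.[x]| <= c * expR (x ^+ 2 / 2).
Proof.
move=> nB; have [b b0 Hb] := nodeless_lower_bound nB; have [a Ha] := poly_le_gauss A.
exists (a / b) => x; rewrite normrM normrV ?unitfE // mulrAC ler_pM ?invr_ge0 //.
by rewrite lef_pV2 ?posrE ?normr_gt0.
Qed.

Lemma ctratio A B : nodeless B -> continuous (fun x => A.[x] / B.[x] * expR (- x ^+ 2)).
Proof.
move=> nB; apply: ctM; last exact: ctgauss.
by apply: ctM; [exact: ctpoly|apply: ctV => //; exact: ctpoly].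
Qed.

Lemma ratio_gauss_integrable A B : nodeless B ->
  mu.-integrable setT (EFin \o (fun x => A.[x] / B.[x] * expR (- x ^+ 2))).
Proof.
move=> nB; have [c Hc] := ratio_bound A nB.
have n1 : (1 : R) != 0 by exact: oner_neq0.
have := integrableZl measurableT (c / normal_peak 1) (integrable_normal_pdf (0 : R) 1).
apply: le_integrable => //.
  by apply/measurable_EFinP; apply: ctmeas => //; exact: ctratio.
move=> x _ /=; rewrite lee_fin normal_pdfE // mulrA divfK; last first.
  by rewrite gt_eqF // normal_peak_gt0.
rewrite normrM (ger0_norm (expR_ge0 _)) (le_trans (ler_wpM2r (expR_ge0 _) (Hc x))) //.
rewrite -mulrA -expRD /normal_fun subr0 expr1n.
rewrite (le_trans _ (ler_norm _)) // le_eqVlt; apply/orP; left; apply/eqP.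
by congr (_ * expR _); field.
Qed.

(** By [gauss_cohom_regular] the two integrands differ by the derivative of a function
    that is smooth and integrable on the whole line. *)
Lemma gauss_cohom_integral A B c : nodeless B -> gauss_cohom A B c ->
  (\int[mu]_x (A.[x] / B.[x] * expR (- x ^+ 2))%:E = (c * Num.sqrt pi)%:E)%E.
Proof.
move=> nB /(gauss_cohom_regular nB) [F [G [nG e]]].
have nG2 : nodeless (G ^+ 2) by move=> x; rewrite horner_exp expf_neq0.
have IA := ratio_gauss_integrable A nB.
have Ic : mu.-integrable setT (EFin \o (fun x => c * expR (- x ^+ 2))).
  exact: (integrableZl measurableT c (@integrableT_gauss R)).
have : (\int[mu]_x ((gauss_num F G).[x] / (G ^+ 2).[x] * expR (- x ^+ 2))%:E = 0)%E.
  apply: (@integral_derive_eq0 _ (fun x => F.[x] / G.[x] * expR (- x ^+ 2))).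
  - move=> x; apply: is_derive_eq (dvM (dvdiv (nG x) (dvpoly F x) (dvpoly G x)) (dvgauss x)) _.
    rewrite horner_exp /gauss_num !(hornerD, hornerM, hornerN, hornerC, hornerX).
    by field; exact: nG.
  - exact: ctratio.
  - exact: ratio_gauss_integrable.
  - exact: ratio_gauss_integrable.
have E x : (gauss_num F G).[x] / (G ^+ 2).[x] * expR (- x ^+ 2) =
   A.[x] / B.[x] * expR (- x ^+ 2) - c * expR (- x ^+ 2).
  have e' : (A.[x] - c * B.[x]) * (G ^+ 2).[x] = B.[x] * (gauss_num F G).[x].
    by rewrite -hornerM -e !(hornerM, hornerD, hornerN, hornerC).
  have -> : (gauss_num F G).[x] = (A.[x] - c * B.[x]) * (G ^+ 2).[x] / B.[x].
    by rewrite e' mulrAC divff ?mul1r // nB.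
  by field; rewrite nB nG2.
under eq_integral do rewrite E EFinB.
rewrite integralB_EFin //.
under [X in (_ - X)%E]eq_integral do rewrite EFinM.
rewrite integralZl //; last exact: integrableT_gauss.
rewrite integralT_gauss.
rewrite -(fineK (integrable_fin_num measurableT IA)) -EFinM -EFinB => -[] /eqP.
by rewrite subr_eq0 => /eqP ->.
Qed.

End GaussianBounds.

(** * Absence of real zeros, and the norms *)

Section KreinAdler.
Local Open Scope classical_set_scope.
Local Open Scope ring_scope.
Variable R : realType.
Local Notation hW := (@hW R).
Implicit Types (x : R) (P : {poly R}) (S : seq nat).

(** In the gauge of the ground state at a level with Wronskians [P1] and [P2], this
    is a solution [v] at the eigenvalue removed just before, with its flux [p v']
    for [p = (P2 / P1) ^ 2 e^(-x^2)]. *)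
Definition subground (P0 P2 : {poly R}) x := P0.[x] / P2.[x] * expR (x ^+ 2).
Definition subground_flux (P0 P1 P2 : {poly R}) x := (flux_num P0 P2).[x] / P1.[x] ^+ 2.

Lemma dvsubground P0 P2 x : nodeless P2 ->
  is_derive x 1 (subground P0 P2) ((flux_num P0 P2).[x] / P2.[x] ^+ 2 * expR (x ^+ 2)).
Proof.
move=> n2; apply: is_derive_eq
  (dvM (dvdiv (n2 x) (dvpoly P0 x) (dvpoly P2 x)) (dvexp (dvsqr x))) _.
rewrite /flux_num !(hornerD, hornerN, hornerM, hornerC, hornerX).
by field; exact: n2.
Qed.

Lemma dvsubground_flux a b P0 P1 P2 x : nodeless P1 -> bil a P0 P1 = 0 -> bil b P1 P2 = 0 ->
  is_derive x 1 (subground_flux P0 P1 P2) ((b - a + 2) * P0.[x] * P2.[x] / P1.[x] ^+ 2).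
Proof.
move=> n1 B0 B1.
have n2 : P1.[x] ^+ 2 != 0 by rewrite expf_neq0.
move: (flux_eq B0 B1); rewrite /subground_flux.
move: (flux_num P0 P2) => M /(congr1 (fun p => p.[x])).
rewrite !(hornerD, hornerN, hornerM, hornerC) => e.
apply: is_derive_eq
  (@dvdiv _ _ (fun t => P1.[t] ^+ 2) x _ _ n2 (dvpoly M x) (dvsq (dvpoly P1 x))) _.
have -> : M^`().[x] = (2 * P1^`().[x] * M.[x] + (b - a + 2) * P0.[x] * P1.[x] * P2.[x]) / P1.[x].
  by rewrite -e; field; exact: n1.
by field; exact: n1.
Qed.

(** A Darboux step backwards keeps the absence of zeros. The function
    [v = P0 e^(x^2) / P2] solves [(p v')' = k p v] with [k > 0], so [p v v'] is
    nondecreasing: by Rolle between two zeros of [v] there would be a common zero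
    of [v] and [v'], which the equation excludes. An even degree excludes a single
    simple zero. *)
Lemma nodeless_step (a b : R) P0 P1 P2 : P0 != 0 -> odd (size P0) ->
  nodeless P1 -> nodeless P2 -> bil a P0 P1 = 0 -> bil b P1 P2 = 0 ->
  0 < b - a + 2 -> nodeless P0.
Proof.
move=> P00 oP0 n1 n2 B0 B1 k0 x; apply/negP => /eqP P0x.
have simple y : P0.[y] = 0 -> P0^`().[y] != 0 by exact: bil_simple_root B0 (n1 y).
suff no2 (y z : R) : y < z -> P0.[y] = 0 -> P0.[z] = 0 -> False.
  have [y yx P0y] := even_degree_second_root P00 oP0 P0x (simple _ P0x).
  by case: (ltgtP x y) yx => // h _; [exact: (no2 x y)|exact: (no2 y x)].
move=> yz P0y P0z.
pose phi t := subground_flux P0 P1 P2 t * subground P0 P2 t.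
pose dphi t := (b - a + 2) * P0.[t] * P2.[t] / P1.[t] ^+ 2 * subground P0 P2 t +
  subground_flux P0 P1 P2 t * ((flux_num P0 P2).[t] / P2.[t] ^+ 2 * expR (t ^+ 2)).
have dv (t : R) : is_derive t 1 phi (dphi t) by apply: dvM; [exact: dvsubground_flux|exact: dvsubground].
have e : phi y = phi z by rewrite /phi /subground P0y P0z !mul0r !mulr0.
have [] := @Rolle _ phi y z yz _ _ e.
- by move=> t _; exact: ex_derive.
- by apply: continuous_subspaceT; exact: dvcont dv.
move=> c _ hc.
have : dphi c = 0.
  by rewrite -(@derive_val _ _ _ _ _ _ _ hc) (@derive_val _ _ _ _ _ _ _ (dv c)).
have -> : dphi c = ((b - a + 2) * (P0.[c] / P1.[c]) ^+ 2 +
   ((flux_num P0 P2).[c] / (P1.[c] * P2.[c])) ^+ 2) * expR (c ^+ 2).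
  by rewrite /dphi /subground /subground_flux; field; rewrite n1 n2.
move=> /eqP; rewrite mulf_eq0 (gt_eqF (expR_gt0 _)) orbF.
rewrite paddr_eq0; last 2 first.
- by rewrite mulr_ge0 ?sqr_ge0 // ltW.
- exact: sqr_ge0.
rewrite mulf_eq0 (gt_eqF k0) /= !expf_eq0 /= !mulf_eq0 !invr_eq0 mulf_eq0.
rewrite (negbTE (n1 c)) (negbTE (n2 c)) !orbF => /andP[/eqP P0c].
rewrite /flux_num !(hornerD, hornerN, hornerM, hornerC, hornerX) P0c !(mul0r, mulr0).
rewrite subr0 addr0 mulf_eq0 (negbTE (n2 c)) orbF => /eqP.
by move/eqP; rewrite (negbTE (simple _ P0c)).
Qed.

(** Induction down the chain of additions of the least missing integer, which ends
    with constant Wronskians. *)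
Lemma adler_nodeless S : adler S -> nodeless (hW S).
Proof.
move: {2}(size (hW S)).+1 (ltnSn (size (hW S))) => n; elim: n S => // n IH S.
move=> sn aS; have [uS ev] := aS; have := size_hW_mex R uS.
have [c0|c0] := posnP (count (fun s => mex S < s)%N S).
  move=> _ x; have /eqP := size_hW_initial R uS c0.
  by move=> /size_poly1P [c c0' ->]; rewrite hornerC.
move=> e; have a1 := adler_rcons aS; have a2 := adler_rcons a1.
have [u1 _] := a1; have := size_hW_mex R u1 => e2.
apply: (nodeless_step (hW_neq0 R uS) (adler_odd_size R aS)
   (IH _ _ a1) (IH _ _ a2) (hW_bil R (mex S) uS) (hW_bil R (mex (rcons S (mex S))) u1)).
- by move: sn c0 e; lia.
- by move: sn c0 e e2; lia.
have := mex_rcons S; rewrite size_rcons -(ltr_nat R) -natr1 => h.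
by move: h; set u := (mex S)%:R; set w := (mex _)%:R; lra.
Qed.

End KreinAdler.

Section Norms.
Local Open Scope classical_set_scope.
Local Open Scope ring_scope.
Variable R : realType.
Local Notation mu := (@lebesgue_measure R).
Local Notation hW := (@hW R).

(** The primitive is the Wronskian of [y] and [z] over [P ^ 2]. *)
Lemma gauss_cohom_orthogonal (a b : R) (P y z : {poly R}) : P != 0 -> a != b ->
  bil a P y = 0 -> bil b P z = 0 -> gauss_cohom (y * z) (P ^+ 2) 0.
Proof.
move=> P0 ab By Bz; exists ((a - b)^-1%:P * (y * z^`() - y^`() * z)), (P ^+ 2).
split; first by rewrite expf_neq0.
have e : gauss_num (y * z^`() - y^`() * z) (P ^+ 2) = (a - b)%:P * (y * z) * P ^+ 2.
  apply/eqP; rewrite -subr_eq0; apply/eqP.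
  transitivity (P * (y * bil b P z - z * bil a P y)); last by rewrite By Bz !mulr0 subrr mulr0.
  rewrite /gauss_num /bil !expr2 !(derivD, derivN, derivM) -!derivn2 polyCB; ring.
have -> : gauss_num ((a - b)^-1%:P * (y * z^`() - y^`() * z)) (P ^+ 2) =
   (a - b)^-1%:P * gauss_num (y * z^`() - y^`() * z) (P ^+ 2).
  by rewrite /gauss_num derivM derivC; ring.
rewrite e.
have -> : P ^+ 2 * ((a - b)^-1%:P * ((a - b)%:P * (y * z) * P ^+ 2)) =
   ((a - b)^-1 * (a - b))%:P * (y * z * (P ^+ 2) ^+ 2) by rewrite polyCM; ring.
by rewrite mulVf ?subr_eq0 // polyC1 polyC0; ring.
Qed.

Lemma hW_inner S k k' : adler S ->
  (\int[mu]_x ((hW (rcons S k) * hW (rcons S k')).[x] / (hW S ^+ 2).[x]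
     * expR (- x ^+ 2))%:E =
   ((k == k')%:R * ((\prod_(s <- S) (2 * (k%:R - s%:R))) * (2 ^+ k * k`!%:R))
     * Num.sqrt pi)%:E)%E.
Proof.
move=> aS; have [uS _] := aS; have nS := adler_nodeless (R := R) aS.
have nS2 : nodeless (hW S ^+ 2) by move=> x; rewrite horner_exp expf_neq0.
apply: gauss_cohom_integral => //; have [<-|kk] := eqVneq k k'.
  by rewrite mul1r -expr2; exact: gauss_cohom_hW.
rewrite mul0r; apply: (gauss_cohom_orthogonal (hW_neq0 R uS) _ (hW_bil R k uS) (hW_bil R k' uS)).
apply: contraNneq kk => e; apply/eqP; apply: (@mulrIn R 1) => //.
by move: e; set u := k%:R; set w := k'%:R; lra.
Qed.

End Norms.

(** * Energy identities and the chain of Darboux maps *)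

Section Energy.
Local Open Scope classical_set_scope.
Local Open Scope ring_scope.
Variable R : realType.
Local Notation mu := (@lebesgue_measure R).
Implicit Types (x : R).

Lemma integral_eq0_cont (B : R -> R) : continuous B -> (forall x, 0 <= B x) ->
  (\int[mu]_x (B x)%:E = 0)%E -> forall x, B x = 0.
Proof.
move=> cB B0 I0 x; apply/eqP; rewrite eq_le B0 andbT leNgt; apply/negP => Bx.
have /(_ x) cBx := cB.
have : \forall t \near x, B x / 2 <= B t.
  have h : B x / 2 < B x by rewrite ltr_pdivrMr // ltr_pMr // ltr1n.
  by apply: filterS (cvgr_gt _ cBx _ h) => t /ltW.
case/nbhs_ballP => e /= e0 He.
pose J := `[x - e / 2, x + e / 2]%classic.
have mJ : measurable J by exact: measurable_itv.
have mB (D : set R) : measurable D -> measurable_fun D (EFin \o B).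
  by move=> mD; apply/measurable_EFinP; exact: ctmeas.
have : (\int[mu]_(t in J) (B x / 2)%:E <= \int[mu]_t (B t)%:E)%E.
  apply: (@le_trans _ _ (\int[mu]_(t in J) (B t)%:E)%E).
    apply: (ge0_le_integral mu mJ).
    - by move=> t _; rewrite lee_fin divr_ge0.
    - exact: measurable_cst.
    - exact: mB.
    - move=> t; rewrite /J /= in_itv /= => tJ; rewrite lee_fin; apply: He.
      by rewrite /ball /= ltr_norml; apply/andP; split; lra.
  apply: (ge0_subset_integral mu mJ measurableT) => //; first exact: mB.
  by move=> t _; rewrite lee_fin.
have muJ : mu J = e%:E.
  rewrite /J lebesgue_measure_itv /= lte_fin ifT; last by lra.
  by rewrite -EFinD; congr EFin; field.
have -> : (\int[mu]_(t in J) (B x / 2)%:E = (B x / 2 * e)%:E)%E.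
  by rewrite (integral_cst mu mJ) [RHS]EFinM; congr (_ * _)%E; exact: muJ.
by rewrite I0 lee_fin leNgt mulr_gt0 ?divr_gt0.
Qed.

(** The system [(p q1')' = - p (k q1 - b q2)], [(p q2')' = - p (k q2 + b q1)] is the
    equation [(p q')' = - (k + i b) p q] for [q = q1 + i q2], with [z = p q']. The
    identities are the integrals of the derivatives of [z1 q1 + z2 q2] and of
    [z1 q2 - z2 q1]; the squares of these two functions add up to the product of
    the two densities, which makes them integrable. *)
Lemma complex_energy (p q1 q2 z1 z2 : R -> R) (k b : R) :
  (forall x, 0 < p x) -> continuous p ->
  (forall x, is_derive x 1 q1 (z1 x / p x)) -> (forall x, is_derive x 1 q2 (z2 x / p x)) ->
  (forall x, is_derive x 1 z1 (- (p x * (k * q1 x - b * q2 x)))) ->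
  (forall x, is_derive x 1 z2 (- (p x * (k * q2 x + b * q1 x)))) ->
  mu.-integrable setT (EFin \o (fun x => p x * (q1 x ^+ 2 + q2 x ^+ 2))) ->
  [/\ mu.-integrable setT (EFin \o (fun x => (z1 x ^+ 2 + z2 x ^+ 2) / p x)),
     (\int[mu]_x ((z1 x ^+ 2 + z2 x ^+ 2) / p x)%:E =
       k%:E * \int[mu]_x (p x * (q1 x ^+ 2 + q2 x ^+ 2))%:E)%E &
     (b%:E * \int[mu]_x (p x * (q1 x ^+ 2 + q2 x ^+ 2))%:E = 0)%E].
Proof.
move=> p0 cp dq1 dq2 dz1 dz2 IB.
have pn0 x : p x != 0 by rewrite gt_eqF.
have [cq1 cq2 cz1 cz2] := And4 (dvcont dq1) (dvcont dq2) (dvcont dz1) (dvcont dz2).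
pose A x := (z1 x ^+ 2 + z2 x ^+ 2) / p x.
pose B x := p x * (q1 x ^+ 2 + q2 x ^+ 2).
have csq (f : R -> R) : continuous f -> continuous (fun x => f x ^+ 2).
  by move=> cf; exact: (ctM cf cf).
have cA : continuous A.
  by apply: ctM; [apply: ctD; exact: csq|exact: ctV].
have cB : continuous B by apply: ctM => //; apply: ctD; exact: csq.
have A0 x : 0 <= A x by rewrite divr_ge0 ?addr_ge0 ?sqr_ge0 // ltW.
have B0 x : 0 <= B x by rewrite mulr_ge0 ?addr_ge0 ?sqr_ge0 // ltW.
pose G x := z1 x * q1 x + z2 x * q2 x.
pose K x := z1 x * q2 x - z2 x * q1 x.
have dG x : is_derive x 1 G (A x - k * B x).
  apply: is_derive_eq (dvD (dvM (dz1 x) (dq1 x)) (dvM (dz2 x) (dq2 x))) _.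
  by rewrite /A /B; field.
have dK x : is_derive x 1 K (b * B x).
  apply: is_derive_eq (dvB (dvM (dz1 x) (dq2 x)) (dvM (dz2 x) (dq1 x))) _.
  by rewrite /B; field.
have ABE x : A x * B x = G x ^+ 2 + K x ^+ 2 by rewrite /A /B /G /K; field.
have GAB x : G x ^+ 2 <= A x * B x by rewrite ABE lerDl sqr_ge0.
have KAB x : K x ^+ 2 <= A x * B x by rewrite ABE lerDr sqr_ge0.
have IA : mu.-integrable setT (EFin \o A).
  exact: (caccioppoli cA cB A0 B0 dG GAB IB).
have dom (f : R -> R) : continuous f -> (forall x, f x ^+ 2 <= A x * B x) ->
    mu.-integrable setT (EFin \o f).
  move=> cf fAB; have := integrableD measurableT IA IB.
  apply: le_integrable => //; first by apply/measurable_EFinP; exact: ctmeas.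
  move=> x _ /=; rewrite lee_fin; apply: le_trans (ler_norm _).
  apply: (le_add_of_sqr (A0 x) (B0 x)).
  have h := mulr_ge0 (A0 x) (B0 x).
  by rewrite (le_trans (fAB x)) //; lra.
have ckB c : continuous (fun x => c * B x) by apply: ctM => //; exact: ctC.
have IkB c : mu.-integrable setT (EFin \o (fun x => c * B x)).
  exact: (integrableZl measurableT c IB).
split=> //.
  have : (\int[mu]_x (A x - k * B x)%:E = 0)%E.
    apply: (integral_derive_eq0 dG); first exact: ctB.
    - by apply: dom => //; exact: dvcont dG.
    - exact: (integrableB measurableT IA (IkB k)).
  under eq_integral do rewrite EFinB.
  rewrite integralB_EFin //.
  under [X in (_ - X)%E]eq_integral do rewrite EFinM.
  rewrite (integralZl measurableT IB).
  rewrite -(fineK (integrable_fin_num measurableT IA)).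
  rewrite -(fineK (integrable_fin_num measurableT IB)).
  by rewrite -!EFinM -EFinB => -[] /eqP; rewrite subr_eq0 => /eqP ->.
rewrite -(integralZl measurableT IB).
under eq_integral do rewrite -EFinM.
apply: (integral_derive_eq0 dK) => //.
by apply: dom => //; exact: dvcont dK.
Qed.

Lemma energy (p q z : R -> R) (k : R) :
  (forall x, 0 < p x) -> continuous p ->
  (forall x, is_derive x 1 q (z x / p x)) ->
  (forall x, is_derive x 1 z (- (p x * (k * q x)))) ->
  mu.-integrable setT (EFin \o (fun x => p x * q x ^+ 2)) ->
  mu.-integrable setT (EFin \o (fun x => z x ^+ 2 / p x)) /\
     (\int[mu]_x (z x ^+ 2 / p x)%:E = k%:E * \int[mu]_x (p x * q x ^+ 2)%:E)%E.
Proof.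
move=> p0 cp dq dz I.
have z2 x : z x ^+ 2 = z x ^+ 2 + (0 : R) ^+ 2 by rewrite expr0n addr0.
have q2 x : q x ^+ 2 = q x ^+ 2 + (0 : R) ^+ 2 by rewrite expr0n addr0.
have [] := @complex_energy p q (fun=> 0) z (fun=> 0) k 0 p0 cp dq _ _ _ _.
- by move=> x; rewrite mul0r; exact: dvC.
- by move=> x; rewrite mul0r subr0; exact: dz.
- by move=> x; rewrite mulr0 mul0r addr0 mulr0 oppr0; exact: dvC.
- by apply: eq_integrable I => // x _ /=; rewrite -q2.
move=> I1 e _; split.
  by apply: eq_integrable I1 => // x _ /=; rewrite -z2.
under eq_integral do rewrite z2; rewrite e; congr (_ * _)%E.
by apply: eq_integral => x _; rewrite -q2.
Qed.

End Energy.

Section Chain.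
Local Open Scope classical_set_scope.
Local Open Scope ring_scope.
Variable R : realType.
Local Notation mu := (@lebesgue_measure R).
Local Notation hW := (@hW R).
Implicit Types (x : R) (S : seq nat).

Definition add_mex S := rcons S (mex S).

Definition weight S x : R := ((hW (add_mex S)).[x] / (hW S).[x]) ^+ 2 * expR (- x ^+ 2).

(** A square-integrable real solution at the set [S] with spectral parameter [nu],
    after division by the ground state [hW (add_mex S)]; [z = p q'] for the weight
    [p]. *)
Definition level S (nu : R) (q z : R -> R) :=
  [/\ forall x, is_derive x 1 q (z x / weight S x),
      forall x, is_derive x 1 z (- (weight S x * (2 * (nu - (mex S)%:R) * q x))) &
      mu.-integrable setT (EFin \o (fun x => weight S x * q x ^+ 2))].

Lemma weight_gt0 S : adler S -> forall x, 0 < weight S x.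
Proof.
move=> aS x; rewrite mulr_gt0 ?expR_gt0 // exprn_even_gt0 //=.
by rewrite mulf_neq0 ?invr_eq0 //; apply: adler_nodeless => //; exact: adler_rcons.
Qed.

Lemma ctweight S : adler S -> continuous (weight S).
Proof.
move=> aS; apply: ctM; last exact: ctgauss.
have h : continuous (fun x => (hW (add_mex S)).[x] / (hW S).[x]).
  by apply: ctM; [exact: ctpoly|apply: ctV; [exact: adler_nodeless|exact: ctpoly]].
exact: (ctM h h).
Qed.

Lemma level_energy S nu q z : adler S -> level S nu q z ->
  mu.-integrable setT (EFin \o (fun x => z x ^+ 2 / weight S x)) /\
     (\int[mu]_x (z x ^+ 2 / weight S x)%:E =
      (2 * (nu - (mex S)%:R))%:E * \int[mu]_x (weight S x * q x ^+ 2)%:E)%E.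
Proof. by move=> aS [dq dz I]; exact: (energy (weight_gt0 aS) (ctweight aS) dq dz I). Qed.

(** The Darboux map [y -> Wr (P1, y) / P0], with [y = P1 q] and with the result
    divided by the ground state [P2] of the next level. *)
Definition darboux_q S (z : R -> R) x := z x * subground (hW S) (hW (add_mex (add_mex S))) x.
Definition darboux_z S (nu : R) (q z : R -> R) x :=
  - (2 * (nu - (mex S)%:R)) * q x *
     ((hW (add_mex (add_mex S))).[x] / (hW S).[x] * expR (- x ^+ 2))
  + z x * subground_flux (hW S) (hW (add_mex S)) (hW (add_mex (add_mex S))) x.

Lemma expRx2 x : expR (x ^+ 2) = (expR (- x ^+ 2))^-1 :> R.
Proof. by rewrite expRN invrK. Qed.

Lemma weight_darboux S z x : adler S ->
  weight (add_mex S) x * darboux_q S z x ^+ 2 = z x ^+ 2 / weight S x.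
Proof.
move=> aS; have a1 := adler_rcons aS; have a2 := adler_rcons a1.
have n0 := adler_nodeless aS; have n1 := adler_nodeless a1; have n2 := adler_nodeless a2.
rewrite /weight /darboux_q /subground expRx2.
by field; rewrite n0 n1 n2 gt_eqF ?expR_gt0.
Qed.

Lemma level_darboux S nu q z : adler S -> level S nu q z ->
  level (add_mex S) nu (darboux_q S z) (darboux_z S nu q z).
Proof.
move=> aS lS; have [dq dz I] := lS; have [uS _] := aS.
have a1 := adler_rcons aS; have a2 := adler_rcons a1; have [u1 _] := a1.
have n0 := adler_nodeless aS; have n1 := adler_nodeless a1; have n2 := adler_nodeless a2.
have B0 := hW_bil R (mex S) uS; have B1 := hW_bil R (mex (add_mex S)) u1.
split.
- move=> x; apply: is_derive_eq (dvM (dz x) (dvsubground _ x (n2 R))) _.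
  rewrite /darboux_z /subground /subground_flux /weight expRx2.
  move: (flux_num _ _) => M; field.
  by rewrite n0 n1 n2 gt_eqF ?expR_gt0.
- move=> x.
  apply: is_derive_eq (dvD (dvM (dvZ _ (dq x)) (dvM (dvdiv (n0 R x) (dvpoly _ x)
    (dvpoly _ x)) (dvgauss x))) (dvM (dz x) (dvsubground_flux x (n1 R) B0 B1))) _.
  rewrite /darboux_q /subground /subground_flux /weight /flux_num expRx2.
  rewrite !(hornerD, hornerN, hornerM, hornerC, hornerX).
  rewrite size_rcons -!natr1.
  by field; rewrite n0 n1 n2 gt_eqF ?expR_gt0.
have [I1 _] := level_energy aS lS.
by apply: eq_integrable I1 => // x _ /=; rewrite weight_darboux.
Qed.

Lemma level_integral_gt0 S nu q z : adler S -> level S nu q z ->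
  (exists x, q x != 0) -> exists2 m : R, 0 < m & (\int[mu]_x (weight S x * q x ^+ 2)%:E = m%:E)%E.
Proof.
move=> aS [dq dz I] [x qx].
have cB : continuous (fun x => weight S x * q x ^+ 2).
  by apply: ctM; [exact: ctweight|have cq := dvcont dq; exact: (ctM cq cq)].
have B0 y : 0 <= weight S y * q y ^+ 2 by rewrite mulr_ge0 ?sqr_ge0 ?ltW ?weight_gt0.
have fI := integrable_fin_num measurableT I.
exists (fine (\int[mu]_x (weight S x * q x ^+ 2)%:E)); last by rewrite fineK.
have i0 : (0 <= \int[mu]_x (weight S x * q x ^+ 2)%:E)%E.
  by apply: integral_ge0 => y _; rewrite lee_fin.
rewrite lt_neqAle fine_ge0 // andbT eq_sym; apply: contra_neq qx => e.
have : (\int[mu]_x (weight S x * q x ^+ 2)%:E = 0)%E by rewrite -(fineK fI) e.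
move=> /(integral_eq0_cont cB B0) /(_ x) /eqP.
by rewrite mulf_eq0 (gt_eqF (weight_gt0 aS x)) /= expf_eq0 /= => /eqP.
Qed.

Lemma notin_add_mex S k : k \notin add_mex S -> k \notin S.
Proof. by rewrite mem_rcons inE negb_or => /andP[]. Qed.

(** Each Darboux map multiplies the squared norm by [2 (nu - mex S)]. The result must
    stay nonnegative although [mex S] grows along the chain, so some factor
    vanishes. *)
Lemma level_spectrum S nu q z : adler S -> level S nu q z -> (exists x, q x != 0) ->
  exists2 k, k \notin S & nu = k%:R.
Proof.
have [n] : exists n, nu < (mex S + n)%:R.
  exists (Num.bound `|nu|).
  rewrite natrD (le_lt_trans (ler_norm _)) // (lt_le_trans (archi_boundP _)) //.
  by rewrite lerDr.
elim: n S q z => [|n IH] S q z nun aS lS q0.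
  have [m m0 e] := level_integral_gt0 aS lS q0.
  have [_] := level_energy aS lS; rewrite e -EFinM => e2.
  have : (0 <= \int[mu]_x (z x ^+ 2 / weight S x)%:E)%E.
    by apply: integral_ge0 => x _; rewrite lee_fin divr_ge0 ?sqr_ge0 ?ltW ?weight_gt0.
  rewrite e2 lee_fin pmulr_lge0 // pmulr_rge0 // subr_ge0 leNgt.
  by move: nun; rewrite addn0 => ->.
have [->|nk] := eqVneq nu (mex S)%:R; first by exists (mex S) => //; exact: mex_notin.
have a1 := adler_rcons aS; have l1 := level_darboux aS lS.
have [||k kS ->] := IH _ _ _ _ a1 l1.
- apply: lt_le_trans nun _; rewrite ler_nat addnS -addSn leq_add2r.
  exact: mex_rcons.
- apply: contrapT => /forallNP h0.
  have [m m0 e] := level_integral_gt0 aS lS q0.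
  have [_] := level_energy aS lS; rewrite e -EFinM.
  rewrite (_ : (fun x => _) = (fun=> 0%E)); last first.
    apply/funext => x; rewrite -weight_darboux //.
    have /negP := h0 x; rewrite negbK => /eqP ->.
    by rewrite expr0n mulr0.
  rewrite integral0 => -[] /esym/eqP.
  by rewrite !mulf_eq0 pnatr_eq0 subr_eq0 (negbTE nk) (gt_eqF m0).
by exists k => //; exact: notin_add_mex.
Qed.

(** At the ground state of a level the energy of [q] is zero, so [q] is constant.
    Otherwise uniqueness at the next level determines [z], and with it [q] because
    [z' = - k p q] with [k] nonzero. *)
Lemma level_unique S k q z : adler S -> k \notin S -> level S k%:R q z ->
  exists c : R, forall x, q x = c * ((hW (rcons S k)).[x] / (hW (add_mex S)).[x]).
Proof.
have [n] : exists n, (k < mex S + n)%N.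
  by exists k.+1; rewrite addnS ltnS leq_addl.
elim: n S q z => [|n IH] S q z kn aS kS lS.
  by move: kS; rewrite mem_lt_mex //; move: kn; rewrite addn0.
have [uS _] := aS; have a1 := adler_rcons aS; have a2 := adler_rcons a1.
have n0 := adler_nodeless aS; have n1 := adler_nodeless a1; have n2 := adler_nodeless a2.
have [dq dz I] := lS.
have [ek|nk] := eqVneq k (mex S).
  have z0 x : z x = 0.
    have [_] := level_energy aS lS; rewrite ek subrr mulr0 mul0e => e.
    have := @integral_eq0_cont _ (fun x => z x ^+ 2 / weight S x) _ _ e x.
    move=> /(_ _ _)/eqP h; apply/eqP; move: h; rewrite mulf_eq0 invr_eq0.
    rewrite (gt_eqF (weight_gt0 aS x)) orbF expf_eq0 /=; apply.
    - apply: ctM; first by have cz := dvcont dz; exact: (ctM cz cz).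
      by apply: ctV; [move=> y; rewrite gt_eqF ?weight_gt0|exact: ctweight].
    - by move=> y; rewrite divr_ge0 ?sqr_ge0 ?ltW ?weight_gt0.
  exists (q 0) => x; rewrite ek divff ?n1 // mulr1.
  apply: is_derive_0_is_cst => y; apply: is_derive_eq (dq y) _.
  by rewrite z0 mul0r.
have l1 := level_darboux aS lS.
have k1 : k \notin add_mex S by rewrite mem_rcons inE negb_or nk.
have [|c hc] := IH _ _ _ _ a1 k1 l1.
  by apply: leq_trans kn _; rewrite addnS -addSn leq_add2r; exact: mex_rcons.
exists c => x.
have kap0 : k%:R - (mex S)%:R != 0 :> R by rewrite subr_eq0 eqr_nat.
pose zy x := (hW (rcons (add_mex S) k)).[x] / (hW S).[x] * expR (- x ^+ 2).
have zE : z = (fun x => c * zy x).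
  apply/funext => y; have := hc y; rewrite /darboux_q /subground /zy expRx2 => e.
  have E0 : expR (- y ^+ 2) != 0 by rewrite gt_eqF ?expR_gt0.
  have h : (hW S).[y] / (hW (add_mex (add_mex S))).[y] / expR (- y ^+ 2) != 0.
    by rewrite !mulf_neq0 ?invr_eq0 ?n0 ?n2.
  by apply: (mulIf h); rewrite e; field; rewrite n0 n2 E0.
have dzy (y : R) : is_derive y 1 zy (- (2 * (k%:R - (mex S)%:R) * (hW (add_mex S)).[y]
     * (hW (rcons S k)).[y] / (hW S).[y] ^+ 2 * expR (- y ^+ 2))).
  apply: is_derive_eq (dvM (dvdiv (n0 R y) (dvpoly _ y) (dvpoly _ y)) (dvgauss y)) _.
  have := congr1 (fun p => p.[y]) (hW_darboux R (mex S) k uS).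
  rewrite !(hornerD, hornerN, hornerM, hornerC, hornerX) => e.
  rewrite /add_mex (mulrC _^`().[y]) (mulrC (hW (rcons (rcons _ _) _)).[y] (hW S)^`().[y]) e.
  by field; exact: n0.
have : is_derive x 1 z (c * - (2 * (k%:R - (mex S)%:R) * (hW (add_mex S)).[x]
     * (hW (rcons S k)).[x] / (hW S).[x] ^+ 2 * expR (- x ^+ 2))).
  by rewrite zE; exact: dvZ (dzy x).
move=> /@derive_val; rewrite (@derive_val _ _ _ _ _ _ _ (dz x)).
have p0 : weight S x * (2 * (k%:R - (mex S)%:R)) != 0.
  by rewrite mulf_neq0 ?(gt_eqF (weight_gt0 aS x)) // mulf_neq0.
move=> e; apply: (mulfI p0); apply: oppr_inj; rewrite -[in LHS]mulrA e /weight.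
by field; rewrite n0 n1.
Qed.

End Chain.

(** * Absolutely continuous functions *)

Section AbsoluteContinuity.
Local Open Scope classical_set_scope.
Local Open Scope ring_scope.
Variable R : realType.
Local Notation mu := (@lebesgue_measure R).
Implicit Types (f g G : R -> R) (a b x : R).

(** Cousin's lemma as an induction along [a, b]; the supremum of the points that can
    be reached is [b]. *)
Lemma cousin_induction (P : R -> Prop) a b : a <= b -> P a ->
  (forall x, a <= x <= b -> exists2 r : R, 0 < r & forall s t,
     a <= s -> t <= b -> x - r < s -> s <= x -> x <= t -> t < x + r -> P s -> P t) ->
  P b.
Proof.
move=> ab Pa step.
pose T := [set t | a <= t <= b /\ P t].
have Ta : T a by rewrite /T /= lexx ab.
have uT : has_ubound T by exists b => t [/andP[]].
have sT : has_sup T by split=> //; exists a.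
pose c := sup T.
have ac : a <= c by exact: ub_le_sup.
have cb : c <= b by apply: ge_sup; [exists a|move=> t [/andP[]]].
have [|r r0 Hr] := step c; first by rewrite ac.
have [s [/andP[a_s sb] Ps] cs] := sup_adherent r0 sT.
have sc : s <= c by apply: ub_le_sup => //; rewrite /T /= a_s sb.
have [cb'|bc] := ltP c b; last first.
  have <- : c = b by apply/eqP; rewrite eq_le cb bc.
  by apply: (Hr s c) => //; rewrite ltrDl.
pose t := Num.min b (c + r / 2).
have ct : c < t by rewrite lt_min cb' /=; lra.
have tb : t <= b by rewrite ge_min lexx.
have tr : t < c + r.
  by apply: (@le_lt_trans _ _ (c + r / 2)); [rewrite ge_min lexx orbT|lra].
have Pt : P t by apply: (Hr s t) => //; exact: ltW.
have : t <= c.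
  apply: ub_le_sup => //; rewrite /T /= tb andbT; split=> //.
  exact: le_trans ac (ltW ct).
by rewrite leNgt ct.
Qed.

Lemma is_derive_eps f x d (e : R) : is_derive x 1 f d -> 0 < e ->
  exists2 r : R, 0 < r & forall t, `|t - x| < r -> `|f t - f x - d * (t - x)| <= e * `|t - x|.
Proof.
move=> [df fd] e0.
have cd : (fun h => h^-1 *: ((f \o shift x) (h *: 1) - f x)) @ 0^' --> d by rewrite -fd.
move/cvgrPdist_lt: cd => /(_ _ e0) /nbhs_ballP[r /= r0 Hr].
exists r => // t tx; have [->|tx0] := eqVneq t x.
  by rewrite !subrr mulr0 subr0 normr0 mulr0.
have t0 : t - x != 0 by rewrite subr_eq0.
have := Hr (t - x); rewrite /ball /= sub0r normrN => /(_ tx t0).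
rewrite /GRing.scale /= mulr1 subrK => h.
have -> : f t - f x - d * (t - x) = - ((d - (t - x)^-1 * (f t - f x)) * (t - x)).
  by field.
by rewrite normrN normrM ler_wpM2r // ltW.
Qed.

(** The family of intervals collected while covering the exceptional null set. *)
Let family a (U : set R) (s : seq (R * R)) t :=
  [/\ all (fun p => (a <= p.1) && (p.1 <= p.2) && (p.2 <= t)) s,
      pairwise (fun p q => p.2 <= q.1) s &
      ((\sum_(p <- s) (p.2 - p.1))%:E <= mu (U `&` `[a, t[))%E].

Lemma family_le a U s t t' : open U -> t <= t' -> family a U s t -> family a U s t'.
Proof.
move=> oU tt' [h1 h2 h3]; split=> //.
  apply: sub_all h1 => p /andP[-> h] /=; exact: le_trans h tt'.
apply: (le_trans h3); apply: le_measure; rewrite ?inE.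
- by apply: measurableI; [exact: open_measurable|exact: measurable_itv].
- by apply: measurableI; [exact: open_measurable|exact: measurable_itv].
apply: setIS => x /=; rewrite !in_itv /= => /andP[-> h] /=; exact: lt_le_trans h tt'.
Qed.

Lemma family_rcons a U s t t' : open U -> a <= t -> t <= t' -> `[t, t'[ `<=` U ->
  family a U s t -> family a U (rcons s (t, t')) t'.
Proof.
move=> oU at_ tt' tU [h1 h2 h3]; split.
- rewrite all_rcons /= lexx andbT tt' at_ /=.
  by apply: sub_all h1 => p /andP[-> h] /=; exact: le_trans h tt'.
- rewrite -cats1 pairwise_cat h2 /= !andbT allrel1r.
  by apply: sub_all h1 => p /andP[_].
have mU (A : R) B : measurable (U `&` `[A, B[).
  by apply: measurableI; [exact: open_measurable|exact: measurable_itv].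
rewrite big_rcons /= EFinD.
apply: (@le_trans _ _ (mu (U `&` `[a, t[) + mu `[t, t'[)%E).
  apply: leeD => //; rewrite lebesgue_measure_itv /= lte_fin.
  case: ltP => h; first by rewrite -EFinB.
  by rewrite lee_fin subr_le0.
have mt : measurable (`[t, t'[ : set R) by exact: measurable_itv.
have dis : (U `&` `[a, t[) `&` `[t, t'[ = set0.
  apply/seteqP; split=> // x [[_ /=]]; rewrite !in_itv /= => /andP[_ h1'] /andP[h2' _].
  by move: h1'; rewrite ltNge h2'.
rewrite -(measureU mu (mU a t) mt dis).
have mUt := measurableU _ _ (mU a t) mt.
apply: le_measure; rewrite ?inE //; first exact: mU.
move=> x [[Ux]|] /=; rewrite in_itv /= => /andP[x1 x2].
  by split=> //=; rewrite in_itv /= x1 (lt_le_trans x2).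
by split; [apply: tU|]; rewrite /= in_itv /= x2 ?x1 // (le_trans at_).
Qed.

Lemma abs_cont_family a b f d e U s : open U ->
  (forall n (u v : 'I_n -> R),
      (forall i, [/\ a <= u i, u i <= v i & v i <= b]) ->
      (forall i j, i != j -> v i <= u j \/ v j <= u i) ->
      \sum_(i < n) (v i - u i) < d ->
      \sum_(i < n) `|f (v i) - f (u i)| < e) ->
  (mu U < d%:E)%E -> family a U s b ->
  \sum_(p <- s) (p.2 - p.1) < d /\ \sum_(p <- s) `|f p.2 - f p.1| < e.
Proof.
move=> oU ac Ud [h1 h2 h3].
have sd : \sum_(p <- s) (p.2 - p.1) < d.
  rewrite -lte_fin; apply: le_lt_trans Ud; apply: (le_trans h3).
  apply: le_measure; rewrite ?inE.
  - by apply: measurableI; [exact: open_measurable|exact: measurable_itv].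
  - exact: open_measurable.
  - by move=> x [].
split=> //.
rewrite (big_nth (0, 0)) big_mkord.
apply: (ac _ (fun i => (nth (0, 0) s i).1) (fun i => (nth (0, 0) s i).2)).
- move=> i; have /allP/(_ (nth (0, 0) s i)) := h1.
  by rewrite mem_nth // => /(_ isT) /andP[/andP[]].
- move=> i j; have /(pairwiseP (0, 0)) pw := h2.
  case: (ltngtP i j) => [ij _|ji _|/val_inj ->]; last by rewrite eqxx.
    by left; apply: pw; rewrite ?inE.
  by right; apply: pw; rewrite ?inE.
by move: sd; rewrite (big_nth (0, 0)) big_mkord.
Qed.

(** Near a point of differentiability the increments of [f - g] are small compared
    with those of the variable. The exceptional null set is covered by an open set
    of small measure; on intervals inside it the increments of [f] are bounded by
    absolute continuity, and those of [g] by the mean value theorem. *)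
Lemma abs_cont_derive_ae f g G a b : a <= b -> abs_cont_on a b f ->
  (forall x, a <= x <= b -> is_derive x 1 g (G x)) -> continuous G ->
  {ae mu, forall x, is_derive x 1 f (G x)} -> f b - f a = g b - g a.
Proof.
move=> ab ac dg cG [N [mN N0 subN]].
pose h x := f x - g x.
suff small (e : R) : 0 < e -> `|h b - h a| <= e.
  suff : h b = h a by rewrite /h; lra.
  apply/eqP; rewrite -subr_eq0 -normr_eq0 eq_le normr_ge0 andbT.
  by apply/ler_addgt0Pl => e e0; rewrite addr0 small.
move=> e0'; pose e1 := e / (b - a + 2).
have ba : 0 <= b - a by rewrite subr_ge0.
have e10 : 0 < e1 by rewrite divr_gt0 //; lra.
have [C C0 HC] : exists2 C : R, 0 < C & forall x, a <= x <= b -> `|G x| <= C.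
  have cG' : {within `[a, b], continuous (fun x => `|G x|)}.
    by apply: continuous_subspaceT => x; apply: cvg_norm; exact: cG.
  have [c _ Hc] := EVT_max ab cG'.
  exists (`|G c| + 1); first by rewrite ltr_wpDl.
  by move=> x xab; rewrite (le_trans (Hc x _)) ?in_itv //= lerDl.
have [d d0 Hd] := ac e1 e10.
pose d1 := Num.min d (e1 / C).
have d10 : 0 < d1 by rewrite lt_min d0 divr_gt0.
have [|U [oU NU UN]] := @lebesgue_regularity_outer R N d1 mN _ d10.
  by rewrite [ltLHS]N0.
have Ud : (mu U < d1%:E)%E.
  have mUN : measurable (U `\` N) by apply: measurableD => //; exact: open_measurable.
  have := measureU2 mu mN mUN; rewrite (setDUK NU) => /le_lt_trans; apply.
  by rewrite [X in (X + _)%E]N0 add0e.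
pose bd s := \sum_(p <- s) (`|f p.2 - f p.1| + C * (p.2 - p.1)).
pose P t := exists2 s, family a U s t & `|h t - h a| <= e1 * (t - a) + bd s.
have Pa : P a.
  exists [::]; last by rewrite /bd big_nil !subrr normr0 mulr0 addr0.
  by split=> //; rewrite big_nil measure_ge0.
suff : P b.
  case=> s fs hs; apply: (le_trans hs).
  have [] := @abs_cont_family a b f d1 e1 U s oU _ Ud fs.
    move=> n u v h1 h2 h3; apply: Hd => //.
    by apply: (lt_le_trans h3); rewrite ge_min lexx.
  move=> s1 s2; rewrite /bd big_split /= -mulr_sumr.
  have s3 : C * \sum_(p <- s) (p.2 - p.1) <= e1.
    rewrite mulrC -ler_pdivlMr // (le_trans (ltW s1)) // ge_min lexx orbT //.
  have e1E : e = e1 * (b - a) + e1 + e1.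
    by rewrite /e1; field; rewrite gt_eqF //; lra.
  rewrite [leRHS]e1E; move: s2 s3.
  by move: (\sum_(_ <- _) `|_|) (C * _) (e1 * _) => X Y Z; lra.
apply: (cousin_induction ab Pa) => x /andP[ax xb].
have xab : a <= x <= b by rewrite ax.
have [Nx|Nx] := pselect (N x).
  have /(open_nbhs_nbhs) : open_nbhs x U by split => //; exact: NU.
  move/nbhs_ballP => [r /= r0 Hr]; exists r => // s t a_s tb xs sx xt tx [l fl hl].
  have st : s <= t by exact: le_trans xt.
  have sU : `[s, t[ `<=` U.
    move=> y /=; rewrite in_itv /= => /andP[sy yt]; apply: Hr.
    by rewrite /ball /= ltr_distlC; apply/andP; split; lra.
  exists (rcons l (s, t)); first exact: family_rcons.
  rewrite /bd big_rcons /= -/(bd l).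
  have gst : `|g t - g s| <= C * (t - s).
    have [|| c ] := @MVT_segment _ g G s t st.
    - move=> y; rewrite in_itv /= => /andP[sy yt]; apply: dg.
      by rewrite (le_trans a_s (ltW sy)) (le_trans (ltW yt) tb).
    - apply: derivable_within_continuous => y; rewrite in_itv /= => /andP[sy yt].
      by have [] := dg y; rewrite ?(le_trans a_s sy) ?(le_trans yt tb).
    rewrite in_itv /= => /andP[sc ct] ->; rewrite normrM.
    rewrite (@ger0_norm _ (t - s)) ?subr_ge0 // ler_wpM2r ?subr_ge0 // HC //.
    by rewrite (le_trans a_s sc) (le_trans ct tb).
  have -> : h t - h a = (h s - h a) + (f t - f s) - (g t - g s) by rewrite /h; ring.
  apply: (le_trans (ler_normB _ _)).
  have h1 := ler_normD (h s - h a) (f t - f s).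
  have h2 : e1 * (s - a) <= e1 * (t - a) by rewrite ler_wpM2l ?lerB // ltW.
  apply: (le_trans (lerD h1 gst)); rewrite [leRHS]addrA [leRHS]addrA !lerD2r.
  by apply: (le_trans hl); rewrite lerD2r.
have fx : is_derive x 1 f (G x) by apply: contrapT => nf; apply: Nx; apply: subN.
have e20 : 0 < e1 / 2 by rewrite divr_gt0.
have [r1 r10 H1] := is_derive_eps fx e20.
have [r2 r20 H2] := is_derive_eps (dg x xab) e20.
have hx t : `|t - x| < Num.min r1 r2 -> `|h t - h x| <= e1 * `|t - x|.
  rewrite lt_min => /andP[/H1 h1 /H2 h2].
  have -> : h t - h x = (f t - f x - G x * (t - x)) - (g t - g x - G x * (t - x)).
    by rewrite /h; ring.
  rewrite (le_trans (ler_normB _ _)) //.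
  have -> : e1 * `|t - x| = e1 / 2 * `|t - x| + e1 / 2 * `|t - x| by field.
  exact: lerD.
exists (Num.min r1 r2); first by rewrite lt_min r10.
move=> s t a_s tb xs sx xt tx [l fl hl].
have st : s <= t by exact: le_trans xt.
exists l; first exact: family_le fl.
have h1 : `|h t - h x| <= e1 * (t - x).
  have := hx t; rewrite ger0_norm ?subr_ge0 //; apply.
  by rewrite ltrBlDl.
have h2 : `|h s - h x| <= e1 * (x - s).
  have := hx s; rewrite distrC ger0_norm ?subr_ge0 //; apply.
  by rewrite ltrBlDl -ltrBlDr.
have -> : h t - h a = (h s - h a) + (h t - h x) - (h s - h x) by ring.
apply: (le_trans (ler_normB _ _)).
have h3 := ler_normD (h s - h a) (h t - h x).
have h4 : e1 * (t - x) + e1 * (x - s) + e1 * (s - a) = e1 * (t - a) by ring.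
by lra.
Qed.

End AbsoluteContinuity.

Section Regularity.
Local Open Scope classical_set_scope.
Local Open Scope ring_scope.
Variable R : realType.
Local Notation mu := (@lebesgue_measure R).
Implicit Types (f g G : R -> R) (a b x : R).

Lemma loc_abs_cont_continuous f : loc_abs_cont f -> continuous f.
Proof.
move=> ac x; apply/cvgrPdist_lt => e e0.
have [d d0 Hd] := ac (x - 1) (x + 1) e e0.
have one (u v : R) : x - 1 <= u -> u <= v -> v <= x + 1 -> v - u < d -> `|f v - f u| < e.
  move=> h1 h2 h3 h4; have := @Hd 1%N (fun=> u) (fun=> v).
  rewrite !big_ord1; apply=> //.
  by move=> i j; rewrite !ord1 eqxx.
have m0 : 0 < Num.min d 1 by rewrite lt_min d0 ltr01.
apply/nbhs_ballP; exists (Num.min d 1) => //= t; rewrite /ball /= lt_min => /andP[td t1].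
move: td t1; rewrite !ltr_norml => /andP[h1 h2] /andP[h3 h4].
rewrite -ltr_norml; have [xt|tx] := leP x t; first by rewrite distrC; apply: one; lra.
by apply: one; lra.
Qed.

Lemma abs_cont_classical f G : loc_abs_cont f -> continuous G ->
  {ae mu, forall x, is_derive x 1 f (G x)} -> forall x, is_derive x 1 f (G x).
Proof.
move=> ac cG ae x; pose A := x - 2.
pose g t := (\int[mu]_(s in [set` `[A, t]]) (G s))%R.
have dg t : A < t -> t < x + 2 -> is_derive t 1 g (G t).
  move=> At tx; have [d1 d2] := @continuous_FTC1_closed _ G A t (x + 2) tx
    (ct_integrable A (x + 2) cG) At (cG t).
  by split=> //; rewrite -d2 derive1E.
have e t : x - 1 <= t -> t <= x + 1 -> f t = g t + (f (x - 1) - g (x - 1)).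
  move=> h1 h2; suff : f t - f (x - 1) = g t - g (x - 1) by lra.
  apply: (abs_cont_derive_ae h1 (ac _ _) _ cG ae) => y /andP[y1 y2].
  by apply: dg; rewrite /A; lra.
have Ax : A < x by rewrite /A; lra.
have xx : x < x + 2 by lra.
have dgx := dvD (dg x Ax xx) (dvC x (f (x - 1) - g (x - 1))).
rewrite -[G x]addr0; apply: near_eq_is_derive dgx.
apply/nbhs_ballP; exists 1 => //= t; rewrite /ball /= ltr_norml => /andP[h1 h2].
by apply/esym/e; lra.
Qed.

Lemma derive_abs_cont f (df : R -> R) : (forall x, is_derive x 1 f (df x)) ->
  continuous df -> loc_abs_cont f.
Proof.
move=> hf cdf a b e e0.
have [ab|ba] := leP a b; last first.
  exists 1 => // n u v h _ _; rewrite big1 // => i _; exfalso.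
  by have [h1 h2 h3] := h i; lra.
have cG' : {within `[a, b], continuous (fun x => `|df x|)}.
  by apply: continuous_subspaceT => x; apply: cvg_norm; exact: cdf.
have [c _ Hc] := EVT_max ab cG'.
pose C := `|df c| + 1; have C0 : 0 < C by rewrite ltr_wpDl.
exists (e / C); first by rewrite divr_gt0.
move=> n u v h _ sd.
apply: (@le_lt_trans _ _ (\sum_(i < n) C * (v i - u i))); last first.
  by rewrite -mulr_sumr mulrC -ltr_pdivlMr.
apply: ler_sum => i _; have [au uv vb] := h i.
have [|t] := @MVT_segment _ f df (u i) (v i) uv (fun y _ => hf y).
  by apply: continuous_subspaceT; exact: dvcont hf.
rewrite in_itv /= => /andP[ut tv] ->; rewrite normrM [X in _ * X]ger0_norm ?subr_ge0 //.
rewrite ler_wpM2r ?subr_ge0 // (le_trans (Hc t _)) ?lerDl //.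
by rewrite in_itv /= (le_trans au ut) (le_trans tv vb).
Qed.

End Regularity.

Local Open Scope complex_scope.

(** * Eigenfunctions *)

Section ComplexParts.
Variable R : realType.
Implicit Types (z : R[i]) (k a b : R).

Lemma Re_realM k z : complex.Re (k%:C * z) = k * complex.Re z.
Proof. by case: z => a b /=; rewrite mul0r subr0. Qed.

Lemma Im_realM k z : complex.Im (k%:C * z) = k * complex.Im z.
Proof. by case: z => a b /=; rewrite mul0r addr0. Qed.

Lemma Re_mulC a b z :
  complex.Re ((a +i* b) * z) = a * complex.Re z - b * complex.Im z.
Proof. by case: z. Qed.

Lemma Im_mulC a b z :
  complex.Im ((a +i* b) * z) = a * complex.Im z + b * complex.Re z.
Proof. by case: z. Qed.

Lemma Re_sub z z' : complex.Re (z - z') = complex.Re z - complex.Re z'.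
Proof. by case: z; case: z'. Qed.

Lemma Im_sub z z' : complex.Im (z - z') = complex.Im z - complex.Im z'.
Proof. by case: z; case: z'. Qed.

Lemma Re_opp z : complex.Re (- z) = - complex.Re z. Proof. by case: z. Qed.
Lemma Im_opp z : complex.Im (- z) = - complex.Im z. Proof. by case: z. Qed.

Lemma complex_ext z z' :
  complex.Re z = complex.Re z' -> complex.Im z = complex.Im z' -> z = z'.
Proof. by case: z => a b; case: z' => a' b' /= -> ->. Qed.

Lemma derivable_derive1 (f : R -> R) (x : R) : derivable f x 1 ->
  is_derive x 1 f (f^`()%classic x).
Proof. by move=> df; rewrite derive1E; exact: derivableP. Qed.

Lemma is_derive_derive1 (f df : R -> R) : (forall x : R, is_derive x 1 f (df x)) ->
  f^`()%classic = df.
Proof. by move=> h; apply/funext => x; rewrite derive1E; exact: derive_val. Qed.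

Lemma ae_imply (P Q : R -> Prop) : (forall x, P x -> Q x) ->
  {ae (@lebesgue_measure R), forall x, P x} -> {ae (@lebesgue_measure R), forall x, Q x}.
Proof.
move=> PQ [N [mN N0 sN]]; exists N; split=> // x nQ.
by apply: sN => Px; apply: nQ; exact: PQ.
Qed.

End ComplexParts.

Section Eigenfunctions.
Variable R : realType.
Local Notation mu := (@lebesgue_measure R).
Local Notation hW := (@hW R).
Implicit Types (x t a b : R) (f g : R -> R) (y : R -> R[i]).
Variables (S : seq nat) (c : R).
Hypotheses (aS : adler S) (c0 : c != 0).

Let P0 := hW S.
Let P1 := hW (add_mex S).
Let eta : {poly R} := c *: P0.
Let W := SL_W eta.
Let Q := SL_R eta.
Let l : R := (size S)%:R.
Let e0 : R := 2 * ((mex S)%:R - l).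

Let n0 : nodeless P0. Proof. exact: adler_nodeless. Qed.
Let n1 : nodeless P1. Proof. by apply: adler_nodeless; exact: adler_rcons. Qed.
Let uS : uniq S. Proof. by case: aS. Qed.

Let etaE x : eta.[x] = c * P0.[x]. Proof. by rewrite hornerZ. Qed.
Let eta1E x : eta^`().[x] = c * P0^`().[x]. Proof. by rewrite derivZ hornerZ. Qed.
Let eta2E x : eta^`(2).[x] = c * P0^`(2).[x].
Proof. by rewrite !derivn2 !derivZ hornerZ. Qed.

Let WE x : W x = (c ^+ 2 * P0.[x] ^+ 2)^-1 * expR (- x ^+ 2).
Proof. by rewrite /W /SL_W etaE exprMn. Qed.

Let W0 x : W x != 0.
Proof. by rewrite WE mulf_neq0 ?invr_eq0 ?mulf_neq0 ?expf_neq0 // gt_eqF ?expR_gt0. Qed.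

(* [V0] is [R / W] and [- V1] is the logarithmic derivative of [W]. *)
Let V0 x : R := P0^`(2).[x] / P0.[x] + 2 * x * (P0^`().[x] / P0.[x]).
Let V1 x : R := 2 * (x + P0^`().[x] / P0.[x]).

Let QE x : Q x = V0 x * W x.
Proof.
rewrite WE /Q /SL_R etaE eta1E eta2E /V0.
by field; rewrite c0 n0.
Qed.

Let dW x : is_derive x 1 W (- V1 x * W x).
Proof.
have h : (c * P0.[x]) ^+ 2 != 0 by rewrite expf_neq0 ?mulf_neq0.
have -> : W = (fun x => ((c * P0.[x]) ^+ 2)^-1 * expR (- x ^+ 2)).
  by apply/funext => t; rewrite WE exprMn.
apply: is_derive_eq (dvM (@dvV _ (fun t => (c * P0.[t]) ^+ 2) x _ h
   (dvsq (dvZ c (dvpoly P0 x)))) (dvgauss x)) _.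
by rewrite /V1; field; rewrite c0 n0.
Qed.

Let ctV0 : continuous V0.
Proof.
have cV : continuous (fun x => (P0.[x])^-1) by apply: ctV => //; exact: ctpoly.
apply: ctD; first by apply: ctM => //; exact: ctpoly.
apply: ctM; last by apply: ctM => //; exact: ctpoly.
by apply: ctM; [exact: ctC|move=> x; exact: cvg_id].
Qed.

Let ctV1 : continuous V1.
Proof.
apply: ctM; first exact: ctC.
apply: ctD; first by move=> x; exact: cvg_id.
by apply: ctM; [exact: ctpoly|apply: ctV => //; exact: ctpoly].
Qed.

(* The right-hand side of the equation solved for the second derivative. *)
Let rhs (f1 f g : R -> R) x : R := V1 x * f1 x - V0 x * f x - g x.

Let rhs_of_flux (f1 f g : R -> R) x d :
  is_derive x 1 (fun t => W t * f1 t) d -> - d - Q x * f x = g x * W x ->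
  is_derive x 1 f1 (rhs f1 f g x).
Proof.
move=> hd e.
have -> : f1 = (fun t => (W t * f1 t) / W t).
  by apply/funext => t; rewrite mulrC mulKf.
apply: is_derive_eq (dvdiv (W0 x) hd (dW x)) _.
have -> : d = - (g x * W x) - Q x * f x by rewrite -e; ring.
by rewrite QE /rhs; field; exact: W0.
Qed.

Let flux_of_rhs (f1 f g : R -> R) x :
  is_derive x 1 f1 (rhs f1 f g x) ->
  is_derive x 1 (fun t => W t * f1 t) (- (g x * W x) - Q x * f x).
Proof.
move=> hd; apply: is_derive_eq (dvM (dW x) hd) _.
by rewrite QE /rhs; ring.
Qed.

(* Dividing by the ground state gives the equation in divergence form. *)
Let qz_of (f f1 : R -> R) x := (f1 x * P1.[x] - f x * P1^`().[x]) / P0.[x] ^+ 2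
  * expR (- x ^+ 2).

Let level_q (f f1 : R -> R) x : is_derive x 1 f (f1 x) ->
  is_derive x 1 (fun t => f t / P1.[t]) (qz_of f f1 x / weight S x).
Proof.
move=> hf; apply: is_derive_eq (dvdiv (n1 x) hf (dvpoly P1 x)) _.
rewrite /qz_of /weight -/P0 -/P1.
by field; rewrite n0 n1 gt_eqF ?expR_gt0.
Qed.

Let level_z (f f1 g : R -> R) x : is_derive x 1 f (f1 x) ->
  is_derive x 1 f1 (rhs f1 f g x) ->
  is_derive x 1 (qz_of f f1) (- (weight S x * (g x / P1.[x] - e0 * (f x / P1.[x])))).
Proof.
move=> hf hf1.
have n2 : P0.[x] ^+ 2 != 0 by rewrite expf_neq0.
apply: is_derive_eq (dvM (@dvdiv _ _ (fun t => P0.[t] ^+ 2) x _ _ n2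
  (dvB (dvM hf1 (dvpoly P1 x)) (dvM hf (dvpoly P1^`() x))) (dvsq (dvpoly P0 x)))
  (dvgauss x)) _.
have B : bil e0 P0 P1 = 0 by exact: hW_bil.
have B2 : P1^`()^`().[x] = (2 * P0^`().[x] * P1^`().[x] - P0^`(2).[x] * P1.[x]
   + 2 * x * (P0.[x] * P1^`().[x] - P0^`().[x] * P1.[x])
   - e0 * P0.[x] * P1.[x]) / P0.[x].
  apply: (mulfI (n0 x)); rewrite [RHS]mulrC divfK ?n0 //.
  have := congr1 (fun p => p.[x]) B; rewrite /bil horner0 (derivn2 P1).
  rewrite !(hornerD, hornerN, hornerM, hornerC, hornerX) => h.
  apply/eqP; rewrite -subr_eq0 -[X in _ == X]h; apply/eqP; ring.
rewrite B2 /rhs /V0 /V1 /weight -/P0 -/P1.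
by field; rewrite n0 n1.
Qed.

Let weightW x (t : R) : weight S x * (t / P1.[x]) ^+ 2 = c ^+ 2 * (t ^+ 2 * W x).
Proof.
rewrite WE /weight -/P0 -/P1.
by field; rewrite n0 n1 c0.
Qed.

(** The second derivatives of the real and imaginary parts agree almost everywhere
    with continuous functions, so by [abs_cont_classical] an eigenfunction is a
    classical solution. *)
Lemma eigenfunction_system a b y : SL_eigenfunction W Q (a +i* b) y ->
  let q1 x := complex.Re (y x) / P1.[x] in
  let q2 x := complex.Im (y x) / P1.[x] in
  exists z1 z2 : R -> R,
  [/\ forall x, is_derive x 1 q1 (z1 x / weight S x),
      forall x, is_derive x 1 q2 (z2 x / weight S x),
      forall x, is_derive x 1 z1 (- (weight S x * ((a - e0) * q1 x - b * q2 x))),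
      forall x, is_derive x 1 z2 (- (weight S x * ((a - e0) * q2 x + b * q1 x))) &
      mu.-integrable setT (EFin \o (fun x => weight S x * (q1 x ^+ 2 + q2 x ^+ 2)))].
Proof.
move=> [_ [mu1 mu2 L2] [acu acv] [dy [acu1 acv1]] ae] q1 q2.
pose u x := complex.Re (y x); pose v x := complex.Im (y x).
pose u1 := u^`()%classic; pose v1 := v^`()%classic.
have du x : is_derive x 1 u (u1 x) by apply: derivable_derive1; case: (dy x).
have dv x : is_derive x 1 v (v1 x) by apply: derivable_derive1; case: (dy x).
have cu := dvcont du; have cv := dvcont dv.
have cu1 : continuous u1 := loc_abs_cont_continuous acu1.
have cv1 : continuous v1 := loc_abs_cont_continuous acv1.
pose g1 x := a * u x - b * v x; pose g2 x := a * v x + b * u x.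
have cg1 : continuous g1 by apply: ctB; apply: ctM => //; exact: ctC.
have cg2 : continuous g2 by apply: ctD; apply: ctM => //; exact: ctC.
have crhs f1 f g : continuous f1 -> continuous f -> continuous g ->
    continuous (rhs f1 f g).
  by move=> ? ? ?; apply: ctB => //; apply: ctB; apply: ctM.
have ReF : (fun t => complex.Re ((W t)%:C * c_derive y t)) = (fun t => W t * u1 t).
  by apply/funext => t; rewrite Re_realM.
have ImF : (fun t => complex.Im ((W t)%:C * c_derive y t)) = (fun t => W t * v1 t).
  by apply/funext => t; rewrite Im_realM.
have ae12 : {ae mu, forall x, is_derive x 1 u1 (rhs u1 u g1 x) /\
     is_derive x 1 v1 (rhs v1 v g2 x)}.
  apply: ae_imply ae => x [[d1 d2] e].
  rewrite ReF in d1; rewrite ImF in d2.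
  have := congr1 (@complex.Re R) e; have := congr1 (@complex.Im R) e.
  rewrite !Re_sub !Im_sub !Re_opp !Im_opp Re_realM Im_realM.
  rewrite -[(a +i* b) * _ * _]mulrA Re_mulC Im_mulC Re_realM Im_realM /c_derive /= ReF ImF => e2 e1.
  split.
  - apply: rhs_of_flux (derivable_derive1 d1) _.
    by rewrite e1 /g1 /u /v; ring.
  - apply: rhs_of_flux (derivable_derive1 d2) _.
    by rewrite e2 /g2 /u /v; ring.
have du1 : forall x, is_derive x 1 u1 (rhs u1 u g1 x).
  apply: abs_cont_classical => //; first exact: crhs.
  by apply: ae_imply ae12 => x [].
have dv1 : forall x, is_derive x 1 v1 (rhs v1 v g2 x).
  apply: abs_cont_classical => //; first exact: crhs.
  by apply: ae_imply ae12 => x [].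
exists (qz_of u u1), (qz_of v v1); split.
- by move=> x; exact: level_q.
- by move=> x; exact: level_q.
- move=> x; apply: is_derive_eq (level_z (du x) (du1 x)) _.
  by rewrite /g1 /q1 /q2; ring.
- move=> x; apply: is_derive_eq (level_z (dv x) (dv1 x)) _.
  by rewrite /g2 /q1 /q2; ring.
have e x : weight S x * (q1 x ^+ 2 + q2 x ^+ 2) = c ^+ 2 * ((u x ^+ 2 + v x ^+ 2) * W x).
  by rewrite mulrDr !weightW -mulrDr -mulrDl.
have W_ge0 x : 0 <= W x.
  by rewrite WE mulr_ge0 ?expR_ge0 // invr_ge0 mulr_ge0 ?sqr_ge0.
have I : mu.-integrable setT (EFin \o (fun x => (u x ^+ 2 + v x ^+ 2) * W x)).
  apply/integrableP; split.
    apply/measurable_EFinP; apply: ctmeas => //; apply: ctM; last exact: dvcont dW.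
    by apply: ctD; [exact: (ctM cu cu)|exact: (ctM cv cv)].
  move: L2; congr (_ < _)%E; apply: eq_integral => x _ /=.
  by rewrite ger0_norm // mulr_ge0 // addr_ge0 ?sqr_ge0.
have := integrableZl measurableT (c ^+ 2) I.
by apply: eq_integrable => // x _ /=; rewrite e.
Qed.

(** The second identity of [complex_energy] reads [b] times the squared norm is 0. *)
Lemma eigenfunction_real a b y : SL_eigenfunction W Q (a +i* b) y ->
  b = 0 /\ exists z1 z2,
    level S (a / 2 + l) (fun x => complex.Re (y x) / P1.[x]) z1 /\
    level S (a / 2 + l) (fun x => complex.Im (y x) / P1.[x]) z2.
Proof.
move=> ef; have [z1 [z2 []]] := eigenfunction_system ef.
set q1 := fun x => _ / _; set q2 := fun x => complex.Im _ / _.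
move=> dq1 dq2 dz1 dz2 I.
have [[x yx] _ _ _ _] := ef.
have cq1 := dvcont dq1; have cq2 := dvcont dq2.
have weight0 := weight_gt0 (R := R) aS; have cweight := ctweight (R := R) aS.
have [_ _ e] := complex_energy weight0 cweight dq1 dq2 dz1 dz2 I.
have cB : continuous (fun x => weight S x * (q1 x ^+ 2 + q2 x ^+ 2)).
  by apply: ctM => //; apply: ctD; [exact: (ctM cq1 cq1)|exact: (ctM cq2 cq2)].
have B0 t : 0 <= weight S t * (q1 t ^+ 2 + q2 t ^+ 2).
  by rewrite mulr_ge0 ?addr_ge0 ?sqr_ge0 // ltW.
have b0 : b = 0.
  apply/eqP; apply: contraNT yx => bn0.
  have I0 : (\int[mu]_x (weight S x * (q1 x ^+ 2 + q2 x ^+ 2))%:E = 0)%E.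
    move: e; rewrite -(fineK (integrable_fin_num measurableT I)) -EFinM => -[] /eqP.
    by rewrite mulf_eq0 (negbTE bn0) /= => /eqP ->.
  have /eqP := integral_eq0_cont cB B0 I0 x.
  rewrite mulf_eq0 (gt_eqF (weight0 x)) /= paddr_eq0 ?sqr_ge0 // !expf_eq0 /=.
  rewrite !mulf_eq0 !invr_eq0 (negbTE (n1 x)) !orbF => /andP[/eqP h1 /eqP h2].
  by apply/eqP; apply: complex_ext.
have kE : 2 * (a / 2 + l - (mex S)%:R) = a - e0 by rewrite /e0; field.
split=> //; exists z1, z2; split; split=> //.
- by move=> t; rewrite kE; apply: is_derive_eq (dz1 t) _; rewrite b0 mul0r subr0.
- apply: le_integrable I => //.
    by apply/measurable_EFinP; apply: ctmeas => //; apply: ctM => //; exact: (ctM cq1 cq1).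
  move=> t _ /=; have h := mulr_ge0 (ltW (weight0 t)) (sqr_ge0 (q1 t)).
  rewrite lee_fin (ger0_norm h) (ger0_norm (B0 t)).
  by apply: ler_wpM2l; [exact: ltW|rewrite lerDl sqr_ge0].
- by move=> t; rewrite kE; apply: is_derive_eq (dz2 t) _; rewrite b0 mul0r addr0.
- apply: le_integrable I => //.
    by apply/measurable_EFinP; apply: ctmeas => //; apply: ctM => //; exact: (ctM cq2 cq2).
  move=> t _ /=; have h := mulr_ge0 (ltW (weight0 t)) (sqr_ge0 (q2 t)).
  rewrite lee_fin (ger0_norm h) (ger0_norm (B0 t)).
  by apply: ler_wpM2l; [exact: ltW|rewrite lerDr sqr_ge0].
Qed.

Lemma eigenvalue_spectrum a b y : SL_eigenfunction W Q (a +i* b) y ->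
  b = 0 /\ exists2 k, k \notin S & a = 2 * (k%:R - l).
Proof.
move=> ef; have [b0 [z1 [z2 [l1 l2]]]] := eigenfunction_real ef; split=> //.
have [[x yx] _ _ _ _] := ef.
suff [k kS e] : exists2 k, k \notin S & a / 2 + l = k%:R.
  by exists k => //; rewrite -e; field.
have [ux|ux] := eqVneq (complex.Re (y x)) 0; last first.
  apply: (level_spectrum aS l1); exists x.
  by rewrite mulf_neq0 ?invr_eq0 ?n1.
apply: (level_spectrum aS l2); exists x; rewrite mulf_neq0 ?invr_eq0 ?n1 //.
by apply: contra_neq yx => vx; apply: complex_ext.
Qed.

Lemma eigenfunction_unique k y : k \notin S ->
  SL_eigenfunction W Q (2 * (k%:R - l))%:C y ->
  exists2 d : R[i], d != 0 & forall x, y x = d * ((hW (rcons S k)).[x])%:C.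
Proof.
move=> kS ef; have [_ [z1 [z2 [l1 l2]]]] := eigenfunction_real ef.
have [[x yx] _ _ _ _] := ef.
have kE : 2 * (k%:R - l) / 2 + l = k%:R by field.
rewrite kE in l1 l2.
have [d1 h1] := level_unique aS kS l1; have [d2 h2] := level_unique aS kS l2.
have e t : y t = (d1 +i* d2) * ((hW (rcons S k)).[t])%:C.
  rewrite mulrC; apply: complex_ext; rewrite ?Re_realM ?Im_realM /=.
    by apply: (mulIf (invr_neq0 (n1 t))); rewrite h1 -/P1; ring.
  by apply: (mulIf (invr_neq0 (n1 t))); rewrite h2 -/P1; ring.
exists (d1 +i* d2) => //.
by apply: contra_neq yx => d0; rewrite e d0 mul0r.
Qed.

Let is_derive_rhs k (t : R) x : let Y := hW (rcons S k) in
  is_derive x 1 (fun s => t * Y^`().[s])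
    (rhs (fun s => t * Y^`().[s]) (fun s => t * Y.[s])
       (fun s => 2 * (k%:R - l) * (t * Y.[s])) x).
Proof.
move=> Y; apply: is_derive_eq (dvZ t (dvpoly Y^`() x)) _.
have B : bil (2 * (k%:R - l)) P0 Y = 0 by exact: hW_bil.
have B2 : Y^`()^`().[x] = (2 * P0^`().[x] * Y^`().[x] - P0^`(2).[x] * Y.[x]
   + 2 * x * (P0.[x] * Y^`().[x] - P0^`().[x] * Y.[x])
   - (2 * (k%:R - l)) * P0.[x] * Y.[x]) / P0.[x].
  apply: (mulfI (n0 x)); rewrite [RHS]mulrC divfK ?n0 //.
  have := congr1 (fun p => p.[x]) B; rewrite /bil horner0 (derivn2 Y).
  rewrite !(hornerD, hornerN, hornerM, hornerC, hornerX) => h.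
  apply/eqP; rewrite -subr_eq0 -[X in _ == X]h; apply/eqP; ring.
by rewrite B2 /rhs /V0 /V1; field; exact: n0.
Qed.

Lemma exists_nonroot (p : {poly R}) : p != 0 -> exists x, p.[x] != 0.
Proof.
move=> p0; exists (cauchy_bound p).
by apply: (ge_cauchy_bound p0); rewrite in_itv /= lexx.
Qed.

Lemma hW_eigenfunction k (d : R[i]) : k \notin S -> d != 0 ->
  SL_eigenfunction W Q (2 * (k%:R - l))%:C (fun x => d * ((hW (rcons S k)).[x])%:C).
Proof.
move=> kS d0; set Y := hW (rcons S k).
case: d d0 => d1 d2 d0.
have Y0 : Y != 0 by apply: hW_neq0; rewrite rcons_uniq kS uS.
have ReY x : complex.Re ((d1 +i* d2) * (Y.[x])%:C) = d1 * Y.[x].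
  by rewrite mulrC Re_realM mulrC.
have ImY x : complex.Im ((d1 +i* d2) * (Y.[x])%:C) = d2 * Y.[x].
  by rewrite mulrC Im_realM mulrC.
have ReYf : (fun x => complex.Re ((d1 +i* d2) * (Y.[x])%:C)) = (fun x => d1 * Y.[x]).
  exact/funext.
have ImYf : (fun x => complex.Im ((d1 +i* d2) * (Y.[x])%:C)) = (fun x => d2 * Y.[x]).
  exact/funext.
have dY t x : is_derive x 1 (fun s => t * Y.[s]) (t * Y^`().[x]).
  exact: dvZ (dvpoly Y x).
have dY1 t x : is_derive x 1 (fun s => t * Y^`().[s]) (t * Y^`()^`().[x]).
  exact: dvZ (dvpoly Y^`() x).
have ctY (p : {poly R}) t : continuous (fun s => t * p.[s]).
  by apply: ctM; [exact: ctC|exact: ctpoly].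
have cder : c_derive (fun x => (d1 +i* d2) * (Y.[x])%:C) =
    (fun x => (d1 * Y^`().[x]) +i* (d2 * Y^`().[x])).
  apply/funext => x; rewrite /c_derive ReYf ImYf.
  by rewrite !(is_derive_derive1 (dY _)).
split.
- have [x Yx] := exists_nonroot Y0; exists x.
  by rewrite mulf_neq0 // eq_complex /= eqxx andbT.
- split.
  + by rewrite ReYf; apply: ctmeas.
  + by rewrite ImYf; apply: ctmeas.
  + have nS2 : nodeless (P0 ^+ 2) by move=> x; rewrite horner_exp expf_neq0.
    have := integrableZl measurableT ((d1 ^+ 2 + d2 ^+ 2) / c ^+ 2)
      (ratio_gauss_integrable (Y ^+ 2) nS2).
    move/integrableP => [_]; congr (_ < _)%E; apply: eq_integral => x _.
    have e : (d1 ^+ 2 + d2 ^+ 2) / c ^+ 2 * ((Y ^+ 2).[x] / (P0 ^+ 2).[x] * expR (- x ^+ 2))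
      = ((d1 * Y.[x]) ^+ 2 + (d2 * Y.[x]) ^+ 2) * W x.
      by rewrite WE !horner_exp; field; rewrite c0 n0.
    rewrite ReY ImY -e /= ger0_norm // e mulr_ge0 ?addr_ge0 ?sqr_ge0 //.
    by rewrite WE mulr_ge0 ?expR_ge0 // invr_ge0 mulr_ge0 ?sqr_ge0.
- by split; rewrite ?ReYf ?ImYf; apply: (derive_abs_cont (dY _)); exact: ctY.
- split.
    by move=> x; split; rewrite ?ReYf ?ImYf; apply: ex_derive; exact: dY.
  by rewrite cder; split => /=; apply: (derive_abs_cont (dY1 _)); exact: ctY.
apply: aeW => x; rewrite cder.
have ReF : (fun t => complex.Re ((W t)%:C * (d1 * Y^`().[t] +i* (d2 * Y^`().[t])))) =
   (fun t => W t * (d1 * Y^`().[t])) by apply/funext => t; rewrite Re_realM.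
have ImF : (fun t => complex.Im ((W t)%:C * (d1 * Y^`().[t] +i* (d2 * Y^`().[t])))) =
   (fun t => W t * (d2 * Y^`().[t])) by apply/funext => t; rewrite Im_realM.
have F (e x' : R) := flux_of_rhs (is_derive_rhs k e x').
split; first by split; rewrite ?ReF ?ImF; apply: ex_derive; exact: F.
rewrite /c_derive ReF ImF !(is_derive_derive1 (F _)).
rewrite -mulrA.
by apply: complex_ext;
  rewrite !(Re_sub, Im_sub, Re_opp, Im_opp, Re_realM, Im_realM) ?ReY ?ImY /=; ring.
Qed.

End Eigenfunctions.

(** * Even partitions *)

Section Partitions.
Variable lam : int_partition.
Local Notation l := (part_len lam).
Local Notation N := (part_size lam).

Lemma part_nth_le i j : (i <= j)%N -> (part_nth lam j <= part_nth lam i)%N.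
Proof. by move=> ij; apply: part_noninc; rewrite -!subn1 leq_sub2r. Qed.

Lemma part_nth_gt i : (l < i)%N -> part_nth lam i = 0%N.
Proof.
rewrite /part_len; case: ex_minnP => m /eqP m0 _ mi.
by apply/eqP; rewrite -leqn0 -m0 part_nth_le.
Qed.

Lemma part_nth_gt0 i : (1 <= i <= l)%N -> (0 < part_nth lam i)%N.
Proof.
case: i => // i /= il; rewrite lt0n; apply/negP => i0.
move: il; rewrite /part_len; case: ex_minnP => m _ /(_ i i0).
by rewrite ltnNge => ->.
Qed.

Lemma part_len_le_size : (l <= N)%N.
Proof.
rewrite /part_size -[leqLHS](subn0 l) -[leqLHS]mul1n -subSS.
rewrite mulnC -sum_nat_const_nat big_nat_cond [leqRHS]big_nat_cond.
by apply: leq_sum => i /andP[/andP[h1 h2] _]; apply: part_nth_gt0; rewrite h1.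
Qed.

Lemma part_m_lt i j : (i < j)%N -> (j <= l)%N -> (part_m lam j < part_m lam i)%N.
Proof. by move=> ij jl; have := part_nth_le (ltnW ij); rewrite /part_m; lia. Qed.

Definition gaps : seq nat := [seq part_m lam i | i <- rev (iota 1 l)].

Lemma size_gaps : size gaps = l.
Proof. by rewrite size_map size_rev size_iota. Qed.

Lemma uniq_gaps : uniq gaps.
Proof.
rewrite map_inj_in_uniq ?rev_uniq ?iota_uniq // => i j.
rewrite !mem_rev !mem_iota !add1n !ltnS => /andP[_ il] /andP[_ jl] e.
by case: (ltngtP i j) => // h; [have := part_m_lt h jl|have := part_m_lt h il];
  rewrite e ltnn.
Qed.

Lemma even_part_len : even_partition lam -> ~~ odd l.
Proof.
move=> ev; apply/negP => ol.
have l0 : (0 < l)%N by case: (l) ol.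
have e : (l.+1)./2.*2 = l.+1 by rewrite even_halfK //= ol.
have h1 : (1 <= (l.+1)./2)%N by move: e l0; case: (l.+1)./2.
have := ev _ h1; rewrite mul2n e subn1 /= (part_nth_gt (ltnSn l)) => h.
by have := @part_nth_gt0 l; rewrite h l0 leqnn => /(_ isT).
Qed.

Lemma count_iota_even (P : pred nat) h :
  (forall i, (i < h)%N -> P (2 * i).+1 = P (2 * i).+2) ->
  ~~ odd (count P (iota 1 h.*2)).
Proof.
elim: h => // h IH e; rewrite doubleS -addn2 iotaD count_cat /= add1n.
have := e h (ltnSn h); rewrite mul2n => ->.
rewrite addn0 addnn oddD odd_double addbF.
by apply: IH => i ih; apply: e; exact: ltnW.
Qed.

(** For an even partition the indices come in pairs of consecutive integers, so that
    an integer outside has evenly many of them above it. *)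
Lemma adler_gaps : even_partition lam -> adler gaps.
Proof.
move=> ev; split=> [|k kS]; first exact: uniq_gaps.
rewrite count_map count_rev -[l]even_halfK ?even_part_len //.
apply: count_iota_even => i il /=.
have il2 : ((2 * i).+2 <= l)%N.
  by rewrite -[l]even_halfK ?even_part_len //; lia.
have e : part_m lam (2 * i).+1 = (part_m lam (2 * i).+2).+1.
  have := ev i.+1 isT; rewrite /part_m mulnS add2n subn1 /=; lia.
have km j : (1 <= j <= l)%N -> k != part_m lam j.
  move=> jl; apply: contraNneq kS => ->; apply: map_f.
  by rewrite mem_rev mem_iota add1n ltnS.
have := km (2 * i).+2; have := km (2 * i).+1.
by rewrite e il2 (ltnW il2) => /(_ isT) h1 /(_ isT) h2; lia.
Qed.

Lemma exc_C_gt0 : 0 < exc_C lam l.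
Proof.
rewrite mulr_gt0 ?exprn_gt0 // big_nat_cond; apply: prodr_gt0 => j _.
rewrite big_nat_cond; apply: prodr_gt0 => i /andP[/andP[_ ij] _].
by have := part_nth_le (ltnW ij); lia.
Qed.

Lemma exc_piE n k : (n + l = k + N)%N ->
  exc_pi lam l n = \prod_(s <- gaps) (k%:Z - s%:Z).
Proof.
move=> nk; rewrite big_map (perm_big (iota 1 l)) ?perm_rev //.
rewrite /exc_pi /index_iota subSS subn0; apply: eq_big_seq => i; rewrite mem_iota add1n ltnS /part_m => /andP[i1 il].
lia.
Qed.

Lemma exc_indexP n : reflect (exists2 k, k \notin gaps & (n + l = k + N)%N)
  (exc_index lam n).
Proof.
have piP k : (n + l = k + N)%N -> (exc_pi lam l n != 0) = (k \notin gaps).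
  move=> nk; rewrite (exc_piE nk) prodf_seq_neq0.
  apply/allP/idP => [h|kS s sS].
    by apply/negP => /h /=; rewrite subrr.
  by rewrite subr_eq0; apply: contraNneq kS => -[->].
apply: (iffP andP) => [[n0 pi0]|[k kS nk]].
  exists (n + l - N)%N; last by lia.
  by rewrite -(piP (n + l - N)%N) //; lia.
by rewrite (piP k nk) kS; split=> //; lia.
Qed.

Lemma prod_shift k d m :
  (\prod_(m.+1 <= i < (m + d).+1) (k%:Z - m%:Z + i%:Z)) * (k`!)%:Z = ((k + d)`!)%:Z.
Proof.
elim: d => [|d IH]; first by rewrite !addn0 big_geq // mul1r.
rewrite !addnS big_nat_recr /= ?ltnS ?leq_addr // factS PoszM -IH.
have -> : k%:Z - m%:Z + (m + d).+1%:Z = (k + d).+1%:Z by lia.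
ring.
Qed.

Lemma exc_pi_size n k : (n + l = k + N)%N ->
  exc_pi lam N n * (k`!)%:Z = exc_pi lam l n * (n`!)%:Z.
Proof.
move=> nk; have lN := part_len_le_size.
rewrite /exc_pi (@big_cat_nat _ _ _ l.+1) //= ?ltnS // -mulrA; congr (_ * _).
have -> : n = (k + (N - l))%N by lia.
rewrite -(prod_shift k (N - l) l) subnKC //; congr (_ * _).
rewrite big_nat_cond [RHS]big_nat_cond; apply: eq_bigr => i /andP[/andP[li _] _].
rewrite part_nth_gt //; lia.
Qed.

End Partitions.

Section Exceptional.
Variables (R : realType) (lam : int_partition).
Local Notation l := (part_len lam).
Local Notation N := (part_size lam).
Local Notation S := (gaps lam).

Lemma wronskian_exc_seq : wronskian (exc_seq R lam) = hW R S.
Proof. by rewrite /hW /exc_seq /gaps -map_comp. Qed.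

Lemma exc_etaE : exc_eta R lam = ((exc_C lam l)%:~R)^-1 *: hW R S.
Proof. by rewrite /exc_eta wronskian_exc_seq. Qed.

Lemma exc_hermiteE n k : (n + l = k + N)%N -> exc_hermite R lam n =
  (2 ^+ l * (exc_C lam l)%:~R * (exc_pi lam l n)%:~R)^-1 *: hW R (rcons S k).
Proof.
move=> nk; rewrite /exc_hermite nk addnK; congr (_ *: wronskian _).
by rewrite /exc_seq /gaps map_rcons -map_comp.
Qed.

Lemma eps_shift n k : (n + l = k + N)%N ->
  2 * (n%:R - N%:R) = (2 * (k%:R - (size S)%:R))%:C :> R[i].
Proof.
move=> nk; rewrite size_gaps rmorphM rmorphB !rmorph_nat; congr (_ * _).
by apply/eqP; rewrite subr_eq addrAC eq_sym subr_eq -!natrD nk.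
Qed.

Lemma exc_pi_prod n k : (n + l = k + N)%N ->
  \prod_(s <- S) (2 * (k%:R - s%:R)) = 2 ^+ l * (exc_pi lam l n)%:~R :> R.
Proof.
move=> nk; rewrite (exc_piE nk) rmorph_prod /=.
rewrite big_split /= big_const_seq count_predT size_gaps iter_mulr_1.
by congr (_ * _); apply: eq_bigr => s _; rewrite rmorphB /= !pmulrn.
Qed.

(** The normalisations turn [prod_s 2 (k - s) 2^k k!] into the stated constant. *)
Lemma norm_constant n k : (n + l = k + N)%N -> exc_pi lam l n != 0 ->
  let a : R := (2 ^+ l * (exc_C lam l)%:~R * (exc_pi lam l n)%:~R)^-1 in
  a * a * (exc_C lam l)%:~R ^+ 2 *
    (\prod_(s <- S) (2 * (k%:R - s%:R)) * (2 ^+ k * k`!%:R)) =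
  2 ^ (n%:Z - N%:Z) * (n`!%:R / (exc_pi lam N n)%:~R).
Proof.
move=> nk p0 a; rewrite (exc_pi_prod nk).
have C0 : (exc_C lam l)%:~R != 0 :> R by rewrite intr_eq0 gt_eqF ?exc_C_gt0.
have p0' : (exc_pi lam l n)%:~R != 0 :> R by rewrite intr_eq0.
have two0 m : 2 ^+ m != 0 :> R by rewrite expf_neq0 ?pnatr_eq0.
have f0 m : m`!%:R != 0 :> R by rewrite pnatr_eq0 -lt0n fact_gt0.
have -> : n%:Z - N%:Z = k%:Z - l%:Z by lia.
have -> : 2 ^ (k%:Z - l%:Z) = 2 ^+ k / 2 ^+ l :> R.
  by rewrite expfzDr ?pnatr_eq0 // exprnN.
have -> : n`!%:R / (exc_pi lam N n)%:~R = k`!%:R / (exc_pi lam l n)%:~R :> R.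
  have := congr1 (fun z : int => z%:~R : R) (exc_pi_size nk).
  rewrite !rmorphM /= -!pmulrn => e.
  have pN : (exc_pi lam N n)%:~R != 0 :> R.
    by apply: contraTneq (mulf_neq0 p0' (f0 n)) => z; rewrite -e z mul0r eqxx.
  by apply/eqP; rewrite eqr_div // mulrC -e mulrC.
by rewrite /a; field; rewrite C0 p0' two0.
Qed.

End Exceptional.

(** * Spectrum, eigenfunctions and norms *)

Theorem theorem4p2 (R : realType) (lam : int_partition) :
  even_partition lam ->
  let eta := exc_eta R lam in
  let N := part_size lam in
  let W := SL_W eta in
  let Q := SL_R eta in
  let eps := fun n : nat => 2 * (n%:R - N%:R) : R[i] in
  [/\ forall e : R[i],
        SL_eigenvalue W Q e <-> exists2 n, exc_index lam n & e = eps n,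
      forall n, exc_index lam n -> forall y : R -> R[i],
        SL_eigenfunction W Q (eps n) y <->
        exists2 c : R[i], c != 0 &
          forall x, y x = c * ((exc_hermite R lam n).[x])%:C
    & forall n n', exc_index lam n -> exc_index lam n' ->
        (\int[@lebesgue_measure R]_x
           ((exc_hermite R lam n).[x] * (exc_hermite R lam n').[x]
            * (eta.[x] ^+ 2)^-1 * expR (- x ^+ 2))%:E
         = (Num.sqrt pi * 2 ^ (n%:Z - N%:Z)
            * (n`!%:R / (exc_pi lam N n)%:~R) * (n == n')%:R)%:E)%E].
Proof.
move=> ev eta N W Q eps.
have aS := adler_gaps ev.
set l := part_len lam.
have C0 : (exc_C lam l)%:~R != 0 :> R by rewrite intr_eq0 gt_eqF ?exc_C_gt0.
have C0' := invr_neq0 C0.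
have WE : W = SL_W (((exc_C lam l)%:~R)^-1 *: hW R (gaps lam)) by rewrite /W /eta exc_etaE.
have QE : Q = SL_R (((exc_C lam l)%:~R)^-1 *: hW R (gaps lam)) by rewrite /Q /eta exc_etaE.
have pi0 n : exc_index lam n -> exc_pi lam l n != 0 by case/andP.
split.
- move=> [a b]; split=> [[y]|[n /exc_indexP [k kS nk] ->]].
    rewrite WE QE => ef; have [b0 [k kS ak]] := eigenvalue_spectrum aS C0' ef.
    have nk : (k + N - l + l = k + N)%N.
      by rewrite subnK // (leq_trans (part_len_le_size lam)) // leq_addl.
    exists (k + N - l)%N; first by apply/exc_indexP; exists k.
    by rewrite /eps (eps_shift R nk) b0 ak.
  rewrite /eps (eps_shift R nk) WE QE; exists (fun x => 1 * ((hW R (rcons (gaps lam) k)).[x])%:C).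
  exact: hW_eigenfunction (oner_neq0 _).
- move=> n idx y; have /exc_indexP [k kS nk] := idx.
  rewrite /eps (eps_shift R nk) WE QE (exc_hermiteE R nk).
  set a : R := (_ * _ * _)^-1.
  have a0 : a != 0.
    by rewrite invr_eq0 !mulf_neq0 ?expf_neq0 ?pnatr_eq0 ?intr_eq0 ?pi0 ?gt_eqF ?exc_C_gt0.
  have aC : a%:C != 0 by rewrite eq_complex /= eqxx andbT.
  split=> [ef|[c c0 yE]].
    have [d d0 yE] := eigenfunction_unique aS C0' kS ef.
    exists (d / a%:C); first by rewrite mulf_neq0 ?invr_eq0.
    by move=> x; rewrite yE hornerZ rmorphM /= mulrA divfK.
  have -> : y = (fun x => (c * a%:C) * ((hW R (rcons (gaps lam) k)).[x])%:C).
    by apply/funext => x; rewrite yE hornerZ rmorphM /= mulrA.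
  by apply: hW_eigenfunction => //; rewrite mulf_neq0.
move=> n n' idx idx'; have /exc_indexP [k kS nk] := idx.
have /exc_indexP [k' kS' nk'] := idx'.
rewrite (exc_hermiteE R nk) (exc_hermiteE R nk').
set a : R := (_ * _ * _)^-1; set a' : R := (_ * _ * (exc_pi lam _ n')%:~R)^-1.
pose K := a * a' * (exc_C lam l)%:~R ^+ 2.
have nS := adler_nodeless (R := R) aS.
have nS2 : nodeless (hW R (gaps lam) ^+ 2) by move=> x; rewrite horner_exp expf_neq0.
under eq_integral => x _.
  rewrite (_ : _ * _ * _ * _ = K * ((hW R (rcons (gaps lam) k) *
      hW R (rcons (gaps lam) k')).[x] / (hW R (gaps lam) ^+ 2).[x] * expR (- x ^+ 2))); last first.
    rewrite /K /eta exc_etaE !hornerZ hornerM horner_exp exprMn.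
    by field; rewrite C0 nS.
  rewrite EFinM.
over.
rewrite integralZl //; last exact: ratio_gauss_integrable.
rewrite (hW_inner R k k' aS) -EFinM; congr EFin.
have -> : (n == n') = (k == k').
  by apply/eqP/eqP => e; move: nk nk'; rewrite e; rewrite -/N; lia.
have [ek|kk] := eqVneq k k'; last by rewrite !mul0r !mulr0.
have en : n' = n by move: nk nk'; rewrite ek; lia.
rewrite mul1r mulr1 -[RHS]mulrA [RHS]mulrC -(norm_constant R nk (pi0 _ idx)).
by rewrite /K /a' en [LHS]mulrA !mulrA.
Qed.
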